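(* Consider the planar system $$\dot X=-Y,\qquad \dot Y=X^3-Y^3 .$$ There exist $\epsilon_0>0$ and real coefficients $X_n$ ($n\ge 1$), independent of $\epsilon$, such that for every $\epsilon$ with $0<\epsilon<\epsilon_0$ the following holds. The solution satisfying $X(0)=\epsilon$, $Y(0)=0$ first returns to the positive $X$-axis at the value $\tilde{\tilde X}$ given by $$\tilde{\tilde X}=\epsilon+\sum_{n=1}^\infty X_n\,\epsilon^{3n+1},$$ which is a convergent series. The coefficients $X_n$ can be calculated iteratively. In particular, $$X_1=-2^{3/2}c_1,\qquad X_2=16\,c_1^2,\qquad X_3=-2^{3/2}\left(20\,c_2c_1+8\,c_3+49\,c_1^3\right),$$ where $c_n=v_n(1)$ for $n=1,2,3$ and $$v_1(\xi)=\xi^{-2}\int_0^\xi t^4p(t)^{3/2}\,dt,\qquad v_2(\xi)=-\frac32\,\xi^{-2}\int_0^\xi t^4p(t)^{1/2}v_1(t)\,dt,$$ $$v_3(\xi)=\xi^{-2}\int_0^\xi t^4\left[-\frac32\,p(t)^{1/2}v_2(t)+\frac38\,\frac{v_1(t)^2}{p(t)^{1/2}}\right]dt,$$ with $p(t)=4-6t^2+4t^4-t^6$.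
   Context: The dot denotes the derivative with respect to time $t$. The point of first return to the positive $X$-axis is $(\tilde{\tilde X},0)$ with $\tilde{\tilde X}=X(t_* )>0$, where $t_*>0$ is the smallest positive time at which $Y(t_* )=0$ and $X(t_* )>0$. The functions $v_n$ are considered for $\xi\in(0,1]$ and extended by $v_n(0)=0$; note that $p(t)\in[1,4]$ for $t\in[0,1]$. *)

(* Defs.v *)
From Stdlib Require Import Reals Arith.
From Coquelicot Require Import Coquelicot.
Open Scope R_scope.

(** Only forward times are considered: solutions may blow up in finite negative
    time.  The two-sided derivative at [t = 0] is harmless, since a solution on
    the half-line extends to a differentiable function on [R]. *)
Definition is_solution (eps : R) (x y : R -> R) : Prop :=
  x 0 = eps /\ y 0 = 0 /\
  forall t : R, 0 <= t ->
    is_derive x t (- y t) /\ is_derive y t (x t ^ 3 - y t ^ 3).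

Definition first_return (x y : R -> R) (ts : R) : Prop :=
  0 < ts /\ y ts = 0 /\ 0 < x ts /\
  forall t : R, 0 < t < ts -> ~ (y t = 0 /\ 0 < x t).

Definition p (t : R) : R := 4 - 6 * t ^ 2 + 4 * t ^ 4 - t ^ 6.

(** At [xi = 0] the integral over [[0, 0]] is [0], so these give [0] there.
    [Rpower] is only meaningful for a positive base; [1 <= p t <= 4] on [[0, 1]]. *)
Definition v1 (xi : R) : R :=
  / xi ^ 2 * RInt (fun t => t ^ 4 * Rpower (p t) (3 / 2)) 0 xi.

Definition v2 (xi : R) : R :=
  - (3 / 2) * / xi ^ 2
  * RInt (fun t => t ^ 4 * Rpower (p t) (1 / 2) * v1 t) 0 xi.

Definition v3 (xi : R) : R :=
  / xi ^ 2
  * RInt (fun t => t ^ 4 * (- (3 / 2) * Rpower (p t) (1 / 2) * v2 t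
                            + 3 / 8 * (v1 t ^ 2 / Rpower (p t) (1 / 2)))) 0 xi.

(** Formal power series are given by their sequences of coefficients. *)
Definition PS_unit (n : nat) : R := if Nat.eqb n 0 then 1 else 0.

Fixpoint PS_pow (a : nat -> R) (m : nat) : nat -> R :=
  match m with
  | O => PS_unit
  | S m' => PS_mult a (PS_pow a m')
  end.

Fixpoint gbinom (a : R) (m : nat) : R :=
  match m with
  | O => 1
  | S m' => gbinom a m' * (a - INR m') / INR (S m')
  end.

(** Coefficient of [mu ^ n] in [(q + sum_(k >= 1) w k * mu ^ k) ^ (3/2)], by the
    binomial series; this assumes [w 0 = 0], so that powers [m > n] of the sum do
    not contribute. *)
Definition pow32_coef (q : R) (w : nat -> R) (n : nat) : R :=
  sum_f_R0
    (fun m => gbinom (3 / 2) m * Rpower q (3 / 2 - INR m) * PS_pow w m n) n.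

(** With [X = eps * (1 - xi ^ 2)], [Y ^ 2 = eps ^ 4 * xi ^ 2 * q xi / 2] and
    [mu = 2 ^ (3/2) * eps ^ 3], the system becomes
    [d (xi ^ 2 * q) / d xi = 8 * xi * (1 - xi ^ 2) ^ 3 - mu * xi ^ 4 * q ^ (3/2)].
    Substituting [q = p - sum_(n >= 1) v n * mu ^ n] yields
    [v (S n) xi = xi ^ (-2) * int_0^xi t ^ 4 * g_n t dt], where [g_n] is the
    coefficient of [mu ^ n] in [q ^ (3/2)] and involves only [v 1, .., v n].
    [v_upto N k] is [v k] for [1 <= k <= N], and [0] for other [k]. *)
Fixpoint v_upto (N : nat) : nat -> R -> R :=
  match N with
  | O => fun _ _ => 0
  | S n => fun k xi =>
      if Nat.eqb k (S n) then
        / xi ^ 2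
        * RInt (fun t => t ^ 4 * pow32_coef (p t) (fun j => - v_upto n j t) n) 0 xi
      else v_upto n k xi
  end.

(** [v 1], [v 2], [v 3] coincide with [v1], [v2], [v3] on [[0, 1]]. *)
Definition v (n : nat) : R -> R := v_upto n n.

(** [q 1 = sum_k crossing_coef k * mu ^ k] gives [Y ^ 2] at [X = 0]. *)
Definition crossing_coef (k : nat) : R := if Nat.eqb k 0 then 1 else - v k 1.

(** Let the solution from [(eps, 0)] first hit the negative [X]-axis at [(- Z, 0)].
    The reflection [(X, Y, t) -> (- X, Y, - t)] reverses the sign of [Y ^ 3] in the
    system, so equating the two values of [Y ^ 2] at [X = 0], with
    [Q mu = sum_k crossing_coef k * mu ^ k] and [kappa = 2 ^ (3/2)], gives
    [Z ^ 4 * Q (- kappa * Z ^ 3) = eps ^ 4 * Q (kappa * eps ^ 3)].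
    With [s = eps ^ 3], [Z = eps * A s] and [A s = sum_k a k * s ^ k], [a 0 = 1],
    the coefficient of [s ^ (S n)] on the left is [4 * a (S n)] plus its value for
    [A] truncated after [s ^ n]; solving for [a (S n)] gives the recursion.
    [half_upto N k] is [a k] for [k <= N], and [0] for [k > N]. *)
Fixpoint half_upto (N : nat) : nat -> R :=
  match N with
  | O => PS_unit
  | S n => fun k =>
      if Nat.eqb k (S n) then
        (crossing_coef (S n) * Rpower 2 (3 / 2) ^ S n
         - sum_f_R0
             (fun j => crossing_coef j * (- Rpower 2 (3 / 2)) ^ j
                       * PS_pow (half_upto n) (3 * j + 4) (S n - j)) (S n)) / 4
      else half_upto n k
  end.

Definition half_coef (n : nat) : R := half_upto n n.

(** By the symmetry [(X, Y) -> (- X, - Y)] the full return map is the half return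
    map applied twice; this is the coefficient of [s ^ n] in
    [A s * A (s * A s ^ 3)]. *)
Definition return_coef (n : nat) : R :=
  sum_f_R0
    (fun k => half_coef k * PS_pow half_coef (3 * k + 1) (n - k)) n.

(* Main.v *)
Require Import Defs.
From Stdlib Require Import Reals Ranalysis5 Lra Lia.
From Coquelicot Require Import Coquelicot.
Open Scope R_scope.

(** The orbit is followed from axis to axis.  Put [X = e * (1 - xi ^ 2)] and
    [Y ^ 2 = e ^ 4 * xi ^ 2 * q / 2].  For [e = eps > 0] this describes the arc in the
    first quadrant, for [e = - Z < 0] the arc in the second quadrant run backwards, and
    in both cases [q] solves one integral equation with the single parameter
    [mu = 2 ^ (3/2) * e ^ 3].

    Analyticity in [mu].  The recursion for the [v n] is the integral equation read
    coefficient by coefficient.  On sequences use the weighted norm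
    [sum_(n <= K) |a n| * rho ^ n], which is submultiplicative for the Cauchy product.
    If the truncation at order [K] of [q - p] has norm at most [1/2], the binomial
    series bounds the truncation of [q ^ (3/2)], and the factor [rho] gained by the
    recursion gives back the bound [1/2] at order [K + 1], uniformly in [xi]
    ([qtail_bound]).  The series may then be summed under the integral sign, which
    yields an actual arc ([qsum_integral], [quarter_orbit], [axis_arc]).

    Following the arc.  If [F] is the value of [Y ^ 2] prescribed by the arc, then
    [W = Y ^ 2 - F X] satisfies [W' = - 2 * Y * (Y ^ 3 - F ^ (3/2))] along a solution,
    so [W * W' <= 0] while [Y >= 0], and [W] stays [0] once it is [0]
    ([stays_on_arc]).  This sign replaces a uniqueness theorem and is indifferent to
    the square root singularity at [Y = 0].  Hence a solution leaving [(eps, 0)]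
    reaches [(- Z, 0)] for any [Z] such that the two arcs meet on the [Y]-axis, that
    is [Z ^ 4 * Q (- kappa * Z ^ 3) = eps ^ 4 * Q (kappa * eps ^ 3)] ([half_turn]).

    Finding [Z].  Take [Z = eps * A (eps ^ 3)], where [A] has the coefficients
    [half_coef].  Their convergence follows from the same kind of induction on
    truncated norms ([half_coef_wnorm]), and the matching condition is their recursion
    read coefficientwise, by the theorem on substitution of power series
    ([is_pseries_subst], [half_equation]).

    The system is invariant under [(X, Y) -> (- X, - Y)], so the lower half turn is the
    upper one started from [(Z, 0)], and a second substitution gives the return map
    ([return_value]).  Global existence comes from Picard iteration for the system with
    truncated cubes; the energy [Y ^ 2 / 2 + X ^ 4 / 4] does not increase and keeps the
    solution where the truncation is inactive ([solution_exists]). *)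

(** The equations are typed in [R] itself, where [ring] and [field] apply. *)
Lemma is_derive_eq (f : R -> R) (x l l' : R) :
  is_derive f x l -> l = l' -> is_derive f x l'.
Proof. now intros H <-. Qed.

Lemma is_series_eq (a : nat -> R) (l l' : R) :
  is_series a l -> l = l' -> is_series a l'.
Proof. now intros H <-. Qed.

Lemma is_pseries_eq (a : nat -> R) (x l l' : R) :
  is_pseries a x l -> l = l' -> is_pseries a x l'.
Proof. now intros H <-. Qed.

(** * Finite sums and weighted norms of formal power series *)

(** Norm of the polynomial truncation at degree [K], so that it is available before
    convergence is known. *)
Definition wnorm (rho : R) (K : nat) (a : nat -> R) : R :=
  sum_f_R0 (fun n => Rabs (a n) * rho ^ n) K.

Definition wbound (rho C : R) (a : nat -> R) : Prop :=
  forall K, wnorm rho K a <= C.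

Lemma sum_swap (T : nat -> nat -> R) (M N : nat) :
  sum_f_R0 (fun m => sum_f_R0 (fun n => T m n) N) M
  = sum_f_R0 (fun n => sum_f_R0 (fun m => T m n) M) N.
Proof.
  induction M as [|M IH]; simpl; [reflexivity|].
  now rewrite IH, <- sum_plus.
Qed.

Lemma sum_extend0 (f : nat -> R) (n N : nat) :
  (n <= N)%nat -> (forall k, (n < k)%nat -> f k = 0) ->
  sum_f_R0 f N = sum_f_R0 f n.
Proof.
  intros H Hf; induction H as [|N H IH]; [reflexivity|].
  simpl; rewrite IH, Hf; [ring|lia].
Qed.

Lemma sum_first (f : nat -> R) (N : nat) :
  (forall k, f (S k) = 0) -> sum_f_R0 f N = f 0%nat.
Proof.
  intros H; rewrite (sum_extend0 f 0 N); [reflexivity|lia|].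
  intros [|k] Hk; [lia|apply H].
Qed.

Lemma sum_triangle_swap (T : nat -> nat -> R) (N : nat) :
  (forall m n, (n < m)%nat -> T m n = 0) ->
  sum_f_R0 (fun n => sum_f_R0 (fun m => T m n) n) N
  = sum_f_R0 (fun m => sum_f_R0 (fun n => T m n) N) N.
Proof.
  intros HT; rewrite sum_swap; apply sum_eq; intros n Hn.
  symmetry; apply sum_extend0; auto.
Qed.

Lemma sum_nonneg (f : nat -> R) (N : nat) :
  (forall n, (n <= N)%nat -> 0 <= f n) -> 0 <= sum_f_R0 f N.
Proof.
  intros H; induction N as [|N IH]; simpl.
  - apply H; lia.
  - apply Rplus_le_le_0_compat; [apply IH; intros; apply H; lia|apply H; lia].
Qed.

Lemma sum_mono_index (f : nat -> R) (n N : nat) :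
  (n <= N)%nat -> (forall k, 0 <= f k) -> sum_f_R0 f n <= sum_f_R0 f N.
Proof.
  intros H Hf; induction H as [|N H IH]; [lra|].
  simpl; specialize (Hf (S N)); lra.
Qed.

Lemma wterm_nonneg rho (a : nat -> R) n : 0 <= rho -> 0 <= Rabs (a n) * rho ^ n.
Proof. intros; apply Rmult_le_pos; [apply Rabs_pos|now apply pow_le]. Qed.

Lemma wnorm_nonneg rho K a : 0 <= rho -> 0 <= wnorm rho K a.
Proof. intros; apply sum_nonneg; intros; now apply wterm_nonneg. Qed.

Lemma wnorm_mono rho K K' a :
  0 <= rho -> (K <= K')%nat -> wnorm rho K a <= wnorm rho K' a.
Proof.
  intros; apply sum_mono_index; auto; intros; now apply wterm_nonneg.
Qed.

Lemma wnorm_ext rho K a b :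
  (forall n, (n <= K)%nat -> a n = b n) -> wnorm rho K a = wnorm rho K b.
Proof. intros H; apply sum_eq; intros; now rewrite H. Qed.

Lemma wnorm_term rho K a n :
  0 <= rho -> (n <= K)%nat -> Rabs (a n) * rho ^ n <= wnorm rho K a.
Proof.
  intros Hr Hn; apply Rle_trans with (wnorm rho n a); [|now apply wnorm_mono].
  unfold wnorm; destruct n as [|n]; simpl; [lra|].
  assert (0 <= sum_f_R0 (fun n => Rabs (a n) * rho ^ n) n) by now apply wnorm_nonneg.
  simpl in *; lra.
Qed.

Lemma wnorm_split rho K a :
  wnorm rho (S K) a = Rabs (a 0%nat) + rho * wnorm rho K (fun n => a (S n)).
Proof.
  unfold wnorm; rewrite decomp_sum by lia.
  rewrite scal_sum; simpl; f_equal; [ring|].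
  apply sum_eq; intros; ring.
Qed.

Lemma wnorm_sum rho (f : nat -> nat -> R) K N :
  0 <= rho ->
  wnorm rho K (fun n => sum_f_R0 (fun m => f m n) N)
  <= sum_f_R0 (fun m => wnorm rho K (f m)) N.
Proof.
  intros Hr; unfold wnorm; rewrite sum_swap.
  apply sum_Rle; intros n _.
  rewrite <- (Rmult_comm (rho ^ n)), Rmult_comm.
  eapply Rle_trans.
  - apply Rmult_le_compat_r; [now apply pow_le|apply Rsum_abs].
  - rewrite Rmult_comm, scal_sum; lra.
Qed.

(** Multiplication by the [m]-th power of the variable *)
Definition PS_shift (m : nat) (a : nat -> R) (n : nat) : R :=
  if Nat.leb m n then a (n - m)%nat else 0.

Lemma wnorm_shift rho K m a :
  0 <= rho -> wnorm rho K (PS_shift m a) <= rho ^ m * wnorm rho K a.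
Proof.
  intros Hr; revert K; induction m as [|m IH]; intros K.
  - simpl; rewrite Rmult_1_l; right; apply wnorm_ext.
    intros; unfold PS_shift; simpl; now rewrite Nat.sub_0_r.
  - destruct K as [|K].
    + unfold wnorm, PS_shift at 1; simpl; rewrite Rabs_R0.
      assert (0 <= rho ^ m) by now apply pow_le.
      assert (0 <= Rabs (a 0%nat)) by apply Rabs_pos.
      assert (0 <= rho * rho ^ m * Rabs (a 0%nat)) by (repeat apply Rmult_le_pos; auto).
      lra.
    + rewrite wnorm_split; unfold PS_shift at 1; simpl Nat.leb; cbn iota.
      rewrite Rabs_R0, Rplus_0_l; simpl pow; rewrite Rmult_assoc.
      apply Rmult_le_compat_l; auto.
      rewrite (wnorm_ext _ _ _ (PS_shift m a)) by reflexivity.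
      eapply Rle_trans; [apply IH|].
      apply Rmult_le_compat_l; [now apply pow_le|apply wnorm_mono; auto].
Qed.

Lemma wnorm_scal rho K c a : wnorm rho K (fun n => c * a n) = Rabs c * wnorm rho K a.
Proof.
  unfold wnorm; rewrite scal_sum; apply sum_eq; intros; rewrite Rabs_mult; ring.
Qed.

Lemma PS_mult_as_sum a b K n :
  (n <= K)%nat ->
  PS_mult a b n = sum_f_R0 (fun m => a m * PS_shift m b n) K.
Proof.
  intros Hn; unfold PS_mult; rewrite (sum_extend0 _ n K); auto.
  - apply sum_eq; intros k Hk; unfold PS_shift.
    apply Nat.leb_le in Hk; now rewrite Hk.
  - intros k Hk; unfold PS_shift.
    apply Nat.leb_gt in Hk; rewrite Hk; ring.
Qed.

Lemma wnorm_mult rho K a b :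
  0 <= rho -> wnorm rho K (PS_mult a b) <= wnorm rho K a * wnorm rho K b.
Proof.
  intros Hr.
  rewrite (wnorm_ext _ _ _ (fun n => sum_f_R0 (fun m => a m * PS_shift m b n) K))
    by (intros; now apply PS_mult_as_sum).
  eapply Rle_trans; [now apply wnorm_sum|].
  unfold wnorm at 2; rewrite Rmult_comm, scal_sum; apply sum_Rle; intros m _.
  rewrite (wnorm_scal _ _ (a m) (PS_shift m b)), Rmult_assoc.
  apply Rmult_le_compat_l; [apply Rabs_pos|now apply wnorm_shift].
Qed.

Lemma wnorm_unit rho K : wnorm rho K PS_unit = 1.
Proof.
  unfold wnorm, PS_unit; rewrite sum_first by (intros; simpl; rewrite Rabs_R0; ring).
  simpl; rewrite Rabs_R1; ring.
Qed.

Lemma wnorm_pow rho K a m :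
  0 <= rho -> wnorm rho K (PS_pow a m) <= wnorm rho K a ^ m.
Proof.
  intros Hr; induction m as [|m IH]; simpl; [rewrite wnorm_unit; lra|].
  eapply Rle_trans; [now apply wnorm_mult|].
  apply Rmult_le_compat_l; auto; now apply wnorm_nonneg.
Qed.

Lemma PS_mult_ext n a a' b b' :
  (forall k, (k <= n)%nat -> a k = a' k) ->
  (forall k, (k <= n)%nat -> b k = b' k) -> PS_mult a b n = PS_mult a' b' n.
Proof.
  intros Ha Hb; apply sum_eq; intros; rewrite Ha, Hb by lia; reflexivity.
Qed.

Lemma PS_pow_ext m n a a' :
  (forall k, (k <= n)%nat -> a k = a' k) -> PS_pow a m n = PS_pow a' m n.
Proof.
  revert n; induction m as [|m IH]; intros n H; simpl; [reflexivity|].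
  apply PS_mult_ext; auto; intros; apply IH; intros; apply H; lia.
Qed.

Lemma PS_pow_low a m n : a 0%nat = 0 -> (n < m)%nat -> PS_pow a m n = 0.
Proof.
  intros Ha; revert n; induction m as [|m IH]; intros n Hn; [lia|].
  simpl; unfold PS_mult; rewrite (sum_eq _ (fun _ => 0)).
  - rewrite sum_cte; ring.
  - intros [|i] Hi; [rewrite Ha; ring|].
    rewrite IH by lia; ring.
Qed.

Lemma PS_pow_abs a m n : Rabs (PS_pow a m n) <= PS_pow (fun k => Rabs (a k)) m n.
Proof.
  revert n; induction m as [|m IH]; intros n; simpl.
  - unfold PS_unit; destruct (Nat.eqb n 0); rewrite ?Rabs_R1, ?Rabs_R0; lra.
  - unfold PS_mult; eapply Rle_trans; [apply Rsum_abs|].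
    apply sum_Rle; intros k _; rewrite Rabs_mult.
    apply Rmult_le_compat_l; [apply Rabs_pos|apply IH].
Qed.

Lemma PS_pow_0 a m : PS_pow a m 0%nat = a 0%nat ^ m.
Proof.
  induction m as [|m IH]; simpl; [reflexivity|].
  unfold PS_mult; simpl; now rewrite IH.
Qed.

(** As the constant terms are [1], each of the [m] factors contributes its difference
    once. *)
Lemma PS_pow_perturb m n a b :
  a 0%nat = 1 -> (forall k, (k <= n)%nat -> a k = b k) ->
  PS_pow a m (S n) - PS_pow b m (S n) = INR m * (a (S n) - b (S n)).
Proof.
  intros Ha Hab; assert (Hb : b 0%nat = 1) by (rewrite <- Hab; [exact Ha|lia]).
  induction m as [|m IH]; [simpl; ring|].
  cbn [PS_pow]; unfold PS_mult.
  rewrite !tech5.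
  rewrite Nat.sub_diag, !PS_pow_0, Ha, Hb, pow1.
  assert (E : sum_f_R0 (fun k => a k * PS_pow a m (S n - k)) n
              - sum_f_R0 (fun k => b k * PS_pow b m (S n - k)) n
              = PS_pow a m (S n) - PS_pow b m (S n)).
  { destruct n as [|n].
    - simpl; rewrite Ha, Hb; ring.
    - rewrite !(decomp_sum _ (S n)) by lia; cbn [Nat.pred Nat.sub].
      rewrite Ha, Hb.
      rewrite (sum_eq (fun i => b (S i) * PS_pow b m (S n - i))
                      (fun i => a (S i) * PS_pow a m (S n - i))).
      + cbn [Nat.sub]. ring.
      + intros i Hi; rewrite Hab by lia.
        f_equal; apply PS_pow_ext; intros; symmetry; apply Hab; lia. }
  rewrite S_INR; lra.
Qed.

Definition PS_trunc (K : nat) (a : nat -> R) (n : nat) : R :=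
  if Nat.leb n K then a n else 0.

Lemma PS_trunc_le K a n : (n <= K)%nat -> PS_trunc K a n = a n.
Proof. intros H; unfold PS_trunc; apply Nat.leb_le in H; now rewrite H. Qed.

Lemma PS_trunc_gt K a n : (K < n)%nat -> PS_trunc K a n = 0.
Proof. intros H; unfold PS_trunc; apply Nat.leb_gt in H; now rewrite H. Qed.

Lemma wbound_trunc rho K C a :
  0 <= rho -> wnorm rho K a <= C -> wbound rho C (PS_trunc K a).
Proof.
  intros Hr H N; eapply Rle_trans; [|exact H].
  destruct (Nat.le_ge_cases N K) as [L|L].
  - eapply Rle_trans; [|apply wnorm_mono; [auto|exact L]].
    right; apply wnorm_ext; intros; apply PS_trunc_le; lia.
  - right; unfold wnorm; rewrite (sum_extend0 _ K N); auto.
    + apply sum_eq; intros; now rewrite PS_trunc_le.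
    + intros; rewrite PS_trunc_gt, Rabs_R0; auto; ring.
Qed.

Lemma wnorm_minus rho K a b :
  0 <= rho -> wnorm rho K (fun n => a n - b n) <= wnorm rho K a + wnorm rho K b.
Proof.
  intros Hr; unfold wnorm; rewrite <- sum_plus; apply sum_Rle; intros n _.
  assert (P : 0 <= rho ^ n) by now apply pow_le.
  rewrite <- Rmult_plus_distr_r; apply Rmult_le_compat_r; auto.
  unfold Rminus; rewrite <- (Rabs_Ropp (b n)); apply Rabs_triang.
Qed.

(** * Values of power series *)

Lemma wbound_nonneg rho C a : 0 <= rho -> wbound rho C a -> 0 <= C.
Proof.
  intros Hr H; apply Rle_trans with (wnorm rho 0 a); auto; now apply wnorm_nonneg.
Qed.

Lemma wbound_mono rho rho' C a :
  0 <= rho' <= rho -> wbound rho C a -> wbound rho' C a.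
Proof.
  intros Hr H K; apply Rle_trans with (wnorm rho K a); auto.
  apply sum_Rle; intros; apply Rmult_le_compat_l; [apply Rabs_pos|now apply pow_incr].
Qed.

Lemma wbound_abs_series rho C a x :
  Rabs x <= rho -> wbound rho C a ->
  ex_series (fun n => Rabs (a n * x ^ n)) /\
  Series (fun n => Rabs (a n * x ^ n)) <= C.
Proof.
  intros Hx H.
  assert (Hb : forall n, sum_n (fun n => Rabs (a n * x ^ n)) n <= C).
  { intros n; rewrite sum_n_Reals; apply Rle_trans with (wnorm rho n a); auto.
    apply sum_Rle; intros; rewrite Rabs_mult, <- RPow_abs.
    apply Rmult_le_compat_l; [apply Rabs_pos|apply pow_incr; split; auto; apply Rabs_pos]. }
  assert (E : ex_series (fun n => Rabs (a n * x ^ n))).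
  { apply ex_finite_lim_seq_incr with C; auto.
    intros n; rewrite sum_Sn; unfold plus; simpl.
    generalize (Rabs_pos (a (S n) * (x * x ^ n))); lra. }
  split; auto.
  assert (L : is_lim_seq (sum_n (fun n => Rabs (a n * x ^ n)))
                (Series (fun n => Rabs (a n * x ^ n)))) by now apply Series_correct.
  apply (is_lim_seq_le _ _ _ _ Hb L (is_lim_seq_const C)).
Qed.

Lemma wbound_is_pseries rho C a x :
  Rabs x <= rho -> wbound rho C a -> is_pseries a x (PSeries a x).
Proof.
  intros Hx H; destruct (wbound_abs_series _ _ _ _ Hx H) as [E _].
  apply PSeries_correct, ex_pseries_R.
  now apply ex_series_Rabs.
Qed.

Lemma wbound_PSeries_abs rho C a x :
  Rabs x <= rho -> wbound rho C a -> Rabs (PSeries a x) <= C.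
Proof.
  intros Hx H; destruct (wbound_abs_series _ _ _ _ Hx H) as [E B].
  eapply Rle_trans; [|apply B]; now apply Series_Rabs.
Qed.

Lemma wbound_radius rho C a x :
  0 < rho -> Rabs x < rho -> wbound rho C a -> Rbar_lt (Rabs x) (CV_radius a).
Proof.
  intros Hr Hx H.
  apply Rbar_lt_le_trans with rho; [exact Hx|].
  destruct (CV_radius_bounded a) as [U _].
  apply U; exists C; intros n.
  rewrite Rabs_mult, (Rabs_pos_eq (rho ^ n)) by (apply pow_le; lra).
  eapply Rle_trans; [|apply (H n)]; apply wnorm_term; lra || lia.
Qed.

Lemma is_pseries_unit x : is_pseries PS_unit x 1.
Proof.
  apply is_pseries_R, is_series_Reals; intros e He; exists 0%nat; intros n _.
  unfold PS_unit, Rdist; rewrite sum_first by (intros; simpl; ring).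
  simpl; rewrite Rmult_1_r, Rminus_diag, Rabs_R0; auto.
Qed.

Lemma wbound_pow rho C a m :
  0 <= rho -> wbound rho C a -> wbound rho (C ^ m) (PS_pow a m).
Proof.
  intros Hr H K; eapply Rle_trans; [now apply wnorm_pow|].
  apply pow_incr; split; auto; now apply wnorm_nonneg.
Qed.

Lemma PSeries_pow rho C a m x :
  0 < rho -> Rabs x < rho -> wbound rho C a ->
  PSeries (PS_pow a m) x = PSeries a x ^ m.
Proof.
  intros Hr Hx H; induction m as [|m IH]; simpl.
  - apply is_pseries_unique, is_pseries_unit.
  - rewrite PSeries_mult, IH; [reflexivity| |].
    + eapply wbound_radius; eauto.
    + eapply wbound_radius; eauto; apply wbound_pow; eauto; lra.
Qed.

(** Halving the radius gains a factor [2 ^ -N] on every term beyond degree [N]. *)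
Lemma PSeries_tail rho C a x N :
  0 < rho -> Rabs x <= rho / 2 -> wbound rho C a ->
  Rabs (PSeries a x - sum_f_R0 (fun n => a n * x ^ n) N) <= C * (/ 2) ^ N.
Proof.
  intros Hr Hx H.
  assert (HC := wbound_nonneg rho C a (Rlt_le _ _ Hr) H).
  assert (B : forall M, Rabs (sum_f_R0 (fun n => a n * x ^ n) (N + M)
                        - sum_f_R0 (fun n => a n * x ^ n) N)
              <= (wnorm rho (N + M) a - wnorm rho N a) * (/ 2) ^ N).
  { induction M as [|M IH].
    - rewrite Nat.add_0_r, !Rminus_diag, Rabs_R0; lra.
    - rewrite Nat.add_succ_r; unfold wnorm in *; rewrite !tech5.
      set (k := (N + M)%nat) in *.
      replace (sum_f_R0 (fun n => a n * x ^ n) k + a (S k) * x ^ S k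
               - sum_f_R0 (fun n => a n * x ^ n) N) with
        ((sum_f_R0 (fun n => a n * x ^ n) k - sum_f_R0 (fun n => a n * x ^ n) N)
         + a (S k) * x ^ S k) by ring.
      eapply Rle_trans; [apply Rabs_triang|].
      assert (T : Rabs (a (S k) * x ^ S k) <= Rabs (a (S k)) * rho ^ S k * (/ 2) ^ N).
      { rewrite Rabs_mult, <- RPow_abs, Rmult_assoc.
        apply Rmult_le_compat_l; [apply Rabs_pos|].
        apply Rle_trans with ((rho / 2) ^ S k).
        - apply pow_incr; split; auto; apply Rabs_pos.
        - unfold Rdiv; rewrite Rpow_mult_distr.
          apply Rmult_le_compat_l; [apply pow_le; lra|].
          replace (S k) with (N + S M)%nat by (unfold k; lia).
          rewrite pow_add; rewrite <- (Rmult_1_r ((/ 2) ^ N)) at 2.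
          apply Rmult_le_compat_l; [apply pow_le; lra|].
          rewrite <- (pow1 (S M)); apply pow_incr; lra. }
      lra. }
  assert (L : is_lim_seq (fun M => Rabs (sum_f_R0 (fun n => a n * x ^ n) (N + M)
                        - sum_f_R0 (fun n => a n * x ^ n) N))
                (Rabs (PSeries a x - sum_f_R0 (fun n => a n * x ^ n) N))).
  { apply (is_lim_seq_abs _ (PSeries a x - sum_f_R0 (fun n => a n * x ^ n) N)).
    apply is_lim_seq_minus'; [|apply is_lim_seq_const].
    assert (P : is_pseries a x (PSeries a x))
      by (apply (wbound_is_pseries rho C); auto; lra).
    apply is_pseries_R in P.
    change (is_lim_seq (sum_n (fun n => a n * x ^ n)) (PSeries a x)) in P.
    apply (is_lim_seq_incr_n _ N) in P.
    eapply is_lim_seq_ext; [|exact P].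
    intros M; simpl; rewrite sum_n_Reals; f_equal; lia. }
  refine (is_lim_seq_le _ _ _ _ _ L (is_lim_seq_const _)).
  intros M; eapply Rle_trans; [apply B|].
  apply Rmult_le_compat_r; [apply pow_le; lra|].
  generalize (H (N + M)%nat) (wnorm_nonneg rho N a); lra.
Qed.

Lemma sum_geom_le r N : 0 <= r < 1 -> sum_f_R0 (fun m => r ^ m) N <= / (1 - r).
Proof.
  intros Hr; rewrite tech3 by lra.
  assert (0 <= r ^ S N) by (apply pow_le; lra).
  rewrite <- (Rmult_1_l (/ (1 - r))); unfold Rdiv.
  apply Rmult_le_compat_r; [left; apply Rinv_0_lt_compat; lra|lra].
Qed.

Lemma PSeries_shift m a x : PSeries (PS_shift m a) x = x ^ m * PSeries a x.
Proof.
  induction m as [|m IH]; simpl.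
  - rewrite Rmult_1_l; apply PSeries_ext; intros n; unfold PS_shift; simpl.
    now rewrite Nat.sub_0_r.
  - rewrite Rmult_assoc, <- IH, <- PSeries_incr_1; apply PSeries_ext.
    intros [|n]; reflexivity.
Qed.

(** * Substitution of power series *)

(** The formal sum of the series [f m], when [f m] has no term of degree below [m] *)
Definition PS_diag (f : nat -> nat -> R) (n : nat) : R :=
  sum_f_R0 (fun m => f m n) n.

Lemma wbound_diag (f : nat -> nat -> R) (rho C r : R) :
  0 < rho -> 0 <= r < 1 -> (forall m n, (n < m)%nat -> f m n = 0) ->
  (forall m, wbound rho (C * r ^ m) (f m)) ->
  wbound rho (C / (1 - r)) (PS_diag f).
Proof.
  intros rho_pos r_lt1 f_low f_bound.
  assert (C_nonneg : 0 <= C).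
  { assert (H := wbound_nonneg rho _ _ (Rlt_le _ _ rho_pos) (f_bound 0%nat)).
    simpl in H; lra. }
  intros K.
  rewrite (wnorm_ext _ _ _ (fun n => sum_f_R0 (fun m => f m n) K)).
  - eapply Rle_trans; [apply wnorm_sum; lra|].
    apply Rle_trans with (sum_f_R0 (fun m => r ^ m * C) K).
    + apply sum_Rle; intros m _; rewrite Rmult_comm; apply f_bound.
    + rewrite <- scal_sum; apply Rmult_le_compat_l; auto; now apply sum_geom_le.
  - intros n Hn; unfold PS_diag; symmetry; apply sum_extend0; auto.
Qed.

(** Exchange of the two summations.  Cutting both sums at [N] leaves, by
    [PSeries_tail], an error [C * r ^ m / 2 ^ N] for the [m]-th series, and these errors
    add up to [O(2 ^ -N)]. *)
Lemma is_pseries_diag (f : nat -> nat -> R) (rho C r : R) :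
  0 < rho -> 0 <= r < 1 -> (forall m n, (n < m)%nat -> f m n = 0) ->
  (forall m, wbound rho (C * r ^ m) (f m)) ->
  forall x, Rabs x <= rho / 2 ->
  ex_series (fun m => PSeries (f m) x) /\
  is_pseries (PS_diag f) x (Series (fun m => PSeries (f m) x)).
Proof.
  intros rho_pos r_lt1 f_low f_bound.
  assert (C_nonneg : 0 <= C).
  { assert (H := wbound_nonneg rho _ _ (Rlt_le _ _ rho_pos) (f_bound 0%nat)).
    simpl in H; lra. }
  intros x Hx.
  assert (E : ex_series (fun m => PSeries (f m) x)).
  { apply (@ex_series_le R_AbsRing R_CompleteNormedModule _ (fun m => C * r ^ m)).
    - intros m; change (Rabs (PSeries (f m) x) <= C * r ^ m).
      apply wbound_PSeries_abs with rho; auto; lra.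
    - apply (ex_series_scal_l C (fun m => r ^ m)), ex_series_geom.
      rewrite Rabs_pos_eq; lra. }
  split; auto.
  apply is_pseries_R.
  change (is_lim_seq (sum_n (fun n => PS_diag f n * x ^ n))
            (Series (fun m => PSeries (f m) x))).
  assert (D : forall N, Rabs (sum_n (fun m => PSeries (f m) x) N
                    - sum_n (fun n => PS_diag f n * x ^ n) N)
                    <= C / (1 - r) * (/ 2) ^ N).
  { intros N; rewrite !sum_n_Reals.
    rewrite (sum_eq (fun n => PS_diag f n * x ^ n)
               (fun n => sum_f_R0 (fun m => f m n * x ^ n) n)).
    2:{ intros n _; unfold PS_diag; rewrite Rmult_comm, scal_sum; reflexivity. }
    rewrite sum_triangle_swap by (intros m n Hmn; rewrite f_low; auto; ring).
    rewrite <- minus_sum.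
    eapply Rle_trans; [apply Rsum_abs|].
    apply Rle_trans with (sum_f_R0 (fun m => r ^ m * (C * (/ 2) ^ N)) N).
    - apply sum_Rle; intros m _.
      eapply Rle_trans; [apply (PSeries_tail rho (C * r ^ m)); auto|lra].
    - rewrite <- scal_sum.
      unfold Rdiv; rewrite !Rmult_assoc, (Rmult_comm (/ (1 - r))), <- !Rmult_assoc.
      apply Rmult_le_compat_l; [apply Rmult_le_pos; auto; apply pow_le; lra|].
      now apply sum_geom_le. }
  assert (Z : is_lim_seq (fun N => sum_n (fun m => PSeries (f m) x) N
                    - sum_n (fun n => PS_diag f n * x ^ n) N) 0).
  { apply is_lim_seq_abs_0.
    apply is_lim_seq_le_le with (fun _ => 0) (fun N => C / (1 - r) * (/ 2) ^ N).
    - intros N; split; [apply Rabs_pos|apply D].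
    - apply is_lim_seq_const.
    - replace (Finite 0) with (Rbar_mult (C / (1 - r)) 0) by (simpl; f_equal; ring).
      apply is_lim_seq_scal_l, is_lim_seq_geom; rewrite Rabs_pos_eq; lra. }
  apply Series_correct in E.
  change (is_lim_seq (sum_n (fun m => PSeries (f m) x))
            (Series (fun m => PSeries (f m) x))) in E.
  assert (F := is_lim_seq_minus' _ _ _ _ E Z).
  rewrite Rminus_0_r in F.
  eapply is_lim_seq_ext; [|exact F]; intros N; simpl; ring.
Qed.

(** With [z] the variable, the terms of [a ^ i * c (z * a ^ 3)] *)
Definition subst_term (c a : nat -> R) (i : nat) (j n : nat) : R :=
  c j * PS_shift j (PS_pow a (3 * j + i)) n.

Lemma subst_term_diag c a i n :
  PS_diag (subst_term c a i) n
  = sum_f_R0 (fun j => c j * PS_pow a (3 * j + i) (n - j)) n.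
Proof.
  apply sum_eq; intros j Hj; unfold subst_term, PS_shift.
  apply Nat.leb_le in Hj; now rewrite Hj.
Qed.

(** The coefficient bound says that [c] converges at [rho * L ^ 3], the largest value
    that the inner series can take at radius [rho]. *)
Lemma is_pseries_subst c a i rho M L r s :
  0 < rho -> 0 <= r < 1 -> 0 <= M -> wbound rho L a ->
  (forall j, Rabs (c j) * rho ^ j * (L ^ 3) ^ j <= M * r ^ j) ->
  Rabs s <= rho / 2 ->
  is_pseries (fun n => sum_f_R0 (fun j => c j * PS_pow a (3 * j + i) (n - j)) n) s
    (PSeries a s ^ i * PSeries c (s * PSeries a s ^ 3)).
Proof.
  intros Hr Hr1 HM Ha Hc Hs.
  assert (PL : 0 <= L) by (eapply wbound_nonneg; [|apply Ha]; lra).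
  assert (Q : 0 <= L ^ i) by (apply pow_le; lra).
  destruct (is_pseries_diag (subst_term c a i) rho (M * L ^ i) r) with (x := s) as [_ H]; auto.
  - intros j n Hj; unfold subst_term, PS_shift.
    apply Nat.leb_gt in Hj; rewrite Hj; ring.
  - intros j K; unfold subst_term; rewrite wnorm_scal.
    apply Rle_trans with (Rabs (c j) * (rho ^ j * L ^ (3 * j + i))).
    + apply Rmult_le_compat_l; [apply Rabs_pos|].
      eapply Rle_trans; [apply wnorm_shift; lra|].
      apply Rmult_le_compat_l; [apply pow_le; lra|].
      apply wbound_pow; auto; lra.
    + rewrite pow_add, pow_mult.
      specialize (Hc j); apply (Rmult_le_compat_r (L ^ i)) in Hc; auto; lra.
  - apply is_pseries_R; apply is_pseries_R in H.
    apply (is_series_ext (fun n => PS_diag (subst_term c a i) n * s ^ n)).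
    { intros n; now rewrite subst_term_diag. }
    refine (eq_rect _ (is_series _) H _ _).
    unfold PSeries at 3; rewrite <- Series_scal_l; apply Series_ext; intros j.
    unfold subst_term; rewrite (PSeries_scal (c j) (PS_shift j (PS_pow a (3 * j + i)))).
    rewrite PSeries_shift, (PSeries_pow rho L) by (auto; lra).
    rewrite pow_add, pow_mult, Rpow_mult_distr; ring.
Qed.

(** * The binomial series with exponent 3/2 *)

Lemma gbinom_bound m : Rabs (gbinom (3 / 2) m) <= 3 / 2.
Proof.
  assert (H : forall m, Rabs (gbinom (3 / 2) (S m)) <= 3 / 2).
  { clear m; induction m as [|m IH].
    - simpl; rewrite Rabs_pos_eq; lra.
    - change (gbinom (3/2) (S (S m)))
        with (gbinom (3/2) (S m) * (3 / 2 - INR (S m)) / INR (S (S m))).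
      unfold Rdiv at 1; rewrite !Rabs_mult, Rabs_inv.
      assert (P : 0 < INR (S (S m))) by (apply lt_0_INR; lia).
      rewrite (Rabs_pos_eq (INR (S (S m)))) by lra.
      assert (B : Rabs (3 / 2 - INR (S m)) <= INR (S (S m))).
      { rewrite (S_INR (S m)), S_INR; assert (0 <= INR m) by apply pos_INR.
        apply Rabs_le; lra. }
      apply Rmult_le_reg_r with (INR (S (S m))); auto.
      rewrite Rmult_assoc, Rinv_l, Rmult_1_r by lra.
      apply Rmult_le_compat; auto using Rabs_pos. }
  destruct m as [|m]; [simpl; rewrite Rabs_R1; lra|apply H].
Qed.

Lemma gbinom_radius z : Rabs z < 1 -> Rbar_lt (Rabs z) (CV_radius (gbinom (3 / 2))).
Proof.
  intros Hz; apply Rbar_lt_le_trans with 1; [exact Hz|].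
  destruct (CV_radius_bounded (gbinom (3 / 2))) as [U _].
  apply U; exists (3 / 2); intros n; rewrite pow1, Rmult_1_r; apply gbinom_bound.
Qed.

(** The recursion for the binomial coefficients, as a differential equation for their
    generating series *)
Lemma gbinom_ode z : Rabs z < 1 ->
  (1 + z) * PSeries (PS_derive (gbinom (3 / 2))) z = 3 / 2 * PSeries (gbinom (3 / 2)) z.
Proof.
  intros Hz; assert (R := gbinom_radius z Hz).
  rewrite Rmult_plus_distr_r, Rmult_1_l.
  rewrite <- PSeries_incr_1, <- PSeries_plus, <- PSeries_scal.
  - apply PSeries_ext; intros [|n].
    + unfold PS_plus, PS_derive, PS_incr_1, PS_scal, plus, scal, zero; simpl.
      unfold mult; simpl; lra.
    + unfold PS_plus, PS_derive, PS_incr_1, PS_scal, plus, scal; simpl Nat.add.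
      unfold mult; cbn -[INR gbinom].
      change (gbinom (3/2) (S (S n)))
        with (gbinom (3/2) (S n) * (3 / 2 - INR (S n)) / INR (S (S n))).
      field; apply not_0_INR; lia.
  - now apply ex_pseries_derive.
  - apply ex_pseries_incr_1; now apply ex_pseries_derive.
Qed.

(** By [gbinom_ode], the quotient of both sides has derivative [0]. *)
Lemma PSeries_gbinom z : Rabs z < 1 ->
  PSeries (gbinom (3 / 2)) z = Rpower (1 + z) (3 / 2).
Proof.
  intros Hz.
  set (f := PSeries (gbinom (3 / 2))).
  set (h := fun z => f z * Rpower (1 + z) (- (3 / 2))).
  assert (D : forall t, Rabs t < 1 -> is_derive h t 0).
  { intros t Ht.
    assert (Hp : 0 < 1 + t) by (apply Rabs_def2 in Ht; lra).
    assert (D1 := is_derive_PSeries _ t (gbinom_radius t Ht)).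
    assert (D2 : is_derive (fun z => Rpower (1 + z) (- (3 / 2))) t
                  (- (3 / 2) * Rpower (1 + t) (- (3 / 2) - 1))).
    { apply is_derive_Reals.
      assert (X := derivable_pt_lim_power (1 + t) (- (3 / 2)) Hp).
      apply is_derive_Reals in X; apply is_derive_Reals.
      assert (X1 : is_derive (fun z => 1 + z) t 1) by (auto_derive; auto).
      assert (Y := is_derive_comp _ _ _ _ _ X X1).
      unfold scal in Y; simpl in Y; unfold mult in Y; simpl in Y.
      now rewrite Rmult_1_l in Y. }
    assert (D3 := is_derive_mult _ _ _ _ _ D1 D2 Rmult_comm).
    unfold plus, mult in D3; simpl in D3.
    refine (is_derive_eq h t _ _ D3 _).
    change (PSeries (gbinom (3/2)) t) with (f t).
    assert (O := gbinom_ode t Ht); fold f in O.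
    replace (- (3 / 2)) with (- (3 / 2) - 1 + 1) at 1 by ring.
    rewrite Rpower_plus, Rpower_1 by auto.
    transitivity (Rpower (1 + t) (- (3/2) - 1) *
       ((1 + t) * PSeries (PS_derive (gbinom (3 / 2))) t - 3/2 * f t)); [ring|].
    rewrite O; ring. }
  assert (E : h z = h 0).
  { destruct (MVT_gen h 0 z (fun _ => 0)) as [c [_ Hc]].
    - intros t Ht; apply D.
      unfold Rmin, Rmax in Ht; apply Rabs_def2 in Hz.
      destruct (Rle_dec 0 z); apply Rabs_def1; lra.
    - intros t Ht.
      assert (Rabs t < 1) by (unfold Rmin, Rmax in Ht; apply Rabs_def2 in Hz;
        destruct (Rle_dec 0 z); apply Rabs_def1; lra).
      apply continuity_pt_filterlim, (ex_derive_continuous h).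
      exists 0; auto.
    - lra. }
  unfold h, f in E; rewrite PSeries_0 in E; simpl in E.
  rewrite Rplus_0_r, Rmult_1_l in E.
  rewrite (Rpower_Ropp 1), (Rpower_Ropp (1 + z)) in E.
  assert (O : Rpower 1 (3/2) = 1) by (unfold Rpower; rewrite ln_1, Rmult_0_r; apply exp_0).
  rewrite O, Rinv_1 in E.
  assert (Hn : Rpower (1 + z) (3 / 2) <> 0) by (unfold Rpower; apply Rgt_not_eq, exp_pos).
  apply (Rmult_eq_compat_r (Rpower (1 + z) (3 / 2))) in E.
  rewrite Rmult_assoc, Rinv_l, Rmult_1_r, Rmult_1_l in E; auto.
Qed.

Lemma Rpower_minus_INR q a m : 0 < q -> Rpower q (a - INR m) = Rpower q a * / q ^ m.
Proof.
  intros Hq; unfold Rminus; rewrite Rpower_plus, Rpower_Ropp, Rpower_pow; auto.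
Qed.

Lemma Rpower_32_sqrt x : 0 < x -> Rpower x (3 / 2) = sqrt x ^ 3.
Proof.
  intros Hx; rewrite <- Rpower_sqrt, <- Rpower_pow by (auto; unfold Rpower; apply exp_pos).
  rewrite Rpower_mult; f_equal; simpl; field.
Qed.

Lemma Rpower_4_32 : Rpower 4 (3 / 2) = 8.
Proof.
  rewrite Rpower_32_sqrt by lra.
  replace 4 with (2 ^ 2) by ring; rewrite sqrt_pow2; lra.
Qed.

Section Pow32.
Variables (q rho : R) (w : nat -> R).
Hypothesis Hq : 1 <= q <= 4.
Hypothesis Hr : 0 < rho.
Hypothesis Hw0 : w 0%nat = 0.
Hypothesis Hw : wbound rho (1 / 2) w.

Let f (m n : nat) : R :=
  gbinom (3 / 2) m * Rpower q (3 / 2 - INR m) * PS_pow w m n.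

Let f_low m n : (n < m)%nat -> f m n = 0.
Proof. intros; unfold f; rewrite PS_pow_low; auto; ring. Qed.

Let f_bound m : wbound rho (12 * (1 / 2) ^ m) (f m).
Proof.
  intros K; unfold f; rewrite wnorm_scal.
  assert (B1 : Rabs (gbinom (3 / 2) m * Rpower q (3 / 2 - INR m)) <= 12).
  { rewrite Rabs_mult, Rpower_minus_INR by lra.
    assert (P : 0 < Rpower q (3/2) <= 8).
    { split; [unfold Rpower; apply exp_pos|].
      rewrite <- Rpower_4_32; apply Rle_Rpower_l; lra. }
    assert (1 <= q ^ m) by (apply pow_R1_Rle; lra).
    assert (I : 0 < / q ^ m <= 1).
    { split; [apply Rinv_0_lt_compat; lra|rewrite <- Rinv_1; apply Rinv_le_contravar; lra]. }
    rewrite (Rabs_pos_eq (_ * _)) by (apply Rmult_le_pos; lra).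
    replace 12 with (3 / 2 * (8 * 1)) by lra.
    apply Rmult_le_compat; [apply Rabs_pos|apply Rmult_le_pos; lra|apply gbinom_bound|].
    apply Rmult_le_compat; lra. }
  apply Rmult_le_compat; [apply Rabs_pos|apply wnorm_nonneg; lra|auto|].
  apply wbound_pow; auto; lra.
Qed.

(** Since [q >= 1], the [m]-th term is at most [12 * (1/2) ^ m] in norm; the radius of
    convergence is therefore independent of [q]. *)
Lemma pow32_bound : wbound rho 24 (pow32_coef q w).
Proof.
  replace 24 with (12 / (1 - 1 / 2)) by field.
  apply (wbound_diag f rho 12 (1 / 2)); auto; lra.
Qed.

Lemma pow32_value x : Rabs x <= rho / 2 ->
  is_pseries (pow32_coef q w) x (Rpower (q + PSeries w x) (3 / 2)).
Proof.
  intros Hx.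
  destruct (is_pseries_diag f rho 12 (1 / 2)) with (x := x) as [_ H]; auto; try lra.
  refine (is_pseries_eq _ _ _ _ H _).
  assert (B : Rabs (PSeries w x) <= 1 / 2) by (apply wbound_PSeries_abs with rho; auto; lra).
  set (z := PSeries w x) in *.
  transitivity (Series (fun m => Rpower q (3 / 2) * (gbinom (3 / 2) m * (z / q) ^ m))).
  - apply Series_ext; intros m; unfold f.
    rewrite (PSeries_scal (gbinom (3 / 2) m * Rpower q (3 / 2 - INR m)) (PS_pow w m)).
    rewrite (PSeries_pow rho (1 / 2)) by (auto; lra).
    rewrite Rpower_minus_INR by lra; fold z.
    unfold Rdiv; rewrite Rpow_mult_distr, pow_inv; ring.
  - rewrite Series_scal_l.
    change (Series (fun m => gbinom (3 / 2) m * (z / q) ^ m))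
      with (PSeries (gbinom (3 / 2)) (z / q)).
    assert (Z : Rabs (z / q) < 1).
    { unfold Rdiv; rewrite Rabs_mult, Rabs_inv, (Rabs_pos_eq q) by lra.
      apply Rmult_lt_reg_r with q; [lra|].
      rewrite Rmult_assoc, Rinv_l by lra; lra. }
    rewrite PSeries_gbinom by auto.
    apply Rabs_def2 in Z.
    rewrite Rpower_mult_distr by lra; f_equal; field; lra.
Qed.
End Pow32.

Lemma pow32_coef_ext q w w' n :
  (forall k, (k <= n)%nat -> w k = w' k) -> pow32_coef q w n = pow32_coef q w' n.
Proof.
  intros H; apply sum_eq; intros m _; f_equal; now apply PS_pow_ext.
Qed.

(** * Continuity and integrals of real functions *)

Definition cont (f : R -> R) : Prop := forall t, continuous f t.

Lemma cont_pt f : cont f <-> forall t, continuity_pt f t.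
Proof. split; intros H t; apply continuity_pt_filterlim, H. Qed.

Lemma cont_ext f g : (forall t, f t = g t) -> cont f -> cont g.
Proof. intros E H t; apply (continuous_ext f); auto. Qed.

Lemma cont_const c : cont (fun _ => c).
Proof. intros t; apply continuous_const. Qed.

Lemma cont_id : cont (fun t => t).
Proof. intros t; apply continuous_id. Qed.

Lemma cont_plus f g : cont f -> cont g -> cont (fun t => f t + g t).
Proof. intros Hf Hg t; apply (continuous_plus f g); auto. Qed.

Lemma cont_opp f : cont f -> cont (fun t => - f t).
Proof. intros Hf t; apply (continuous_opp f); auto. Qed.

Lemma cont_minus f g : cont f -> cont g -> cont (fun t => f t - g t).
Proof. intros Hf Hg t; apply (continuous_minus f g); auto. Qed.

Lemma cont_mult f g : cont f -> cont g -> cont (fun t => f t * g t).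
Proof. intros Hf Hg t; apply (continuous_mult f g); auto. Qed.

Lemma cont_comp f g : cont f -> cont g -> cont (fun t => g (f t)).
Proof. intros Hf Hg t; apply (continuous_comp f g); auto. Qed.

Lemma cont_pow f n : cont f -> cont (fun t => f t ^ n).
Proof.
  intros Hf; induction n as [|n IH]; [exact (cont_const 1)|exact (cont_mult f _ Hf IH)].
Qed.

Lemma cont_abs f : cont f -> cont (fun t => Rabs (f t)).
Proof.
  intros Hf; apply (cont_comp f Rabs); auto.
  apply cont_pt; intros t; apply Rcontinuity_abs.
Qed.

Lemma cont_sqrt f : cont f -> cont (fun t => sqrt (f t)).
Proof. intros Hf; apply (cont_comp f sqrt); auto; intros t; apply continuous_sqrt. Qed.

Lemma cont_sum (f : nat -> R -> R) N :
  (forall n, (n <= N)%nat -> cont (f n)) -> cont (fun t => sum_f_R0 (fun n => f n t) N).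
Proof.
  intros H; induction N as [|N IH]; simpl; [now apply H|].
  apply cont_plus; [apply IH; auto|auto].
Qed.

Lemma cont_Rpower f a :
  (forall t, 0 < f t) -> cont f -> cont (fun t => Rpower (f t) a).
Proof.
  intros Hp Hf t; unfold Rpower.
  apply (continuous_comp (fun t => a * ln (f t)) exp).
  - apply (continuous_mult (fun _ => a) (fun t => ln (f t))); [apply continuous_const|].
    apply (continuous_comp f ln); auto.
    apply (ex_derive_continuous ln); exists (/ f t).
    apply is_derive_Reals, derivable_pt_lim_ln; auto.
  - apply (ex_derive_continuous exp); exists (exp (a * ln (f t))).
    apply is_derive_Reals, derivable_pt_lim_exp.
Qed.

Lemma is_lim_seq_geom_half C : is_lim_seq (fun N => C * (/ 2) ^ N) 0.
Proof.
  replace (Finite 0) with (Rbar_mult C 0) by (simpl; f_equal; ring).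
  apply is_lim_seq_scal_l, is_lim_seq_geom; rewrite Rabs_pos_eq; lra.
Qed.

(** The error bound is only asked to be uniform near each point: for Picard iterates it
    grows with time. *)
Lemma cont_uniform_limit (f : nat -> R -> R) (h C : R -> R) :
  (forall N, cont (f N)) ->
  (forall N t s, Rabs (s - t) < 1 -> Rabs (h s - f N s) <= C t * (/ 2) ^ N) -> cont h.
Proof.
  intros Hf Hh; apply cont_pt; intros t.
  apply (CVU_continuity f h t (mkposreal 1 Rlt_0_1)).
  - intros e He.
    assert (L := is_lim_seq_geom_half (C t)).
    apply is_lim_seq_Reals in L; destruct (L e He) as [N HN].
    exists N; intros n y Hn Hy; specialize (HN n Hn).
    unfold Rdist in HN; rewrite Rminus_0_r in HN.
    eapply Rle_lt_trans; [apply (Hh n t), Hy|].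
    eapply Rle_lt_trans; [apply Rle_abs|auto].
  - intros n y _; now apply cont_pt.
  - unfold Boule; simpl; rewrite Rminus_diag, Rabs_R0; lra.
Qed.

Lemma eq_0_of_geometric_bound a C : (forall N, Rabs a <= C * (/ 2) ^ N) -> a = 0.
Proof.
  intros H.
  assert (L := is_lim_seq_geom_half C).
  assert (B := is_lim_seq_le _ _ _ _ H (is_lim_seq_const _) L); simpl in B.
  destruct (Req_dec a 0) as [E|E]; auto.
  apply Rabs_pos_lt in E; lra.
Qed.

Lemma cont_ex_RInt f a b : cont f -> ex_RInt f a b.
Proof. intros H; apply (ex_RInt_continuous f); auto. Qed.

Lemma RInt_mult_r f c a b :
  cont f -> RInt (fun t => f t * c) a b = RInt f a b * c.
Proof.
  intros Hf; apply (is_RInt_unique (V := R_CompleteNormedModule)).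
  rewrite Rmult_comm.
  apply (is_RInt_ext (fun t => scal c (f t))).
  - intros t _; apply Rmult_comm.
  - apply (is_RInt_scal f), (RInt_correct f), cont_ex_RInt, Hf.
Qed.

Lemma RInt_abs_const f a b M :
  a <= b -> cont f -> (forall t, a <= t <= b -> Rabs (f t) <= M) ->
  Rabs (RInt f a b) <= M * (b - a).
Proof.
  intros Hab Hf HM; rewrite Rmult_comm.
  apply (norm_RInt_le_const f a b (RInt f a b) M Hab HM).
  apply (RInt_correct f), cont_ex_RInt, Hf.
Qed.

(** The absolute values are summed before the integral is estimated: only the whole
    sum of the integrands is bounded, not each of them by a summable constant. *)
Lemma sum_RInt_bound (f : nat -> R -> R) N a b M :
  a <= b -> (forall n, (n <= N)%nat -> cont (f n)) ->
  (forall t, a <= t <= b -> sum_f_R0 (fun n => Rabs (f n t)) N <= M) ->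
  sum_f_R0 (fun n => Rabs (RInt (f n) a b)) N <= M * (b - a).
Proof.
  intros Hab Hf HM.
  assert (C : forall n, (n <= N)%nat -> cont (fun t => sum_f_R0 (fun k => Rabs (f k t)) n))
    by (intros n Hn; apply cont_sum; intros k Hk; apply cont_abs, Hf; lia).
  apply Rle_trans with (RInt (fun t => sum_f_R0 (fun n => Rabs (f n t)) N) a b).
  - clear HM; induction N as [|N IH]; simpl.
    + apply abs_RInt_le; auto; apply cont_ex_RInt, Hf; lia.
    + rewrite (RInt_plus (fun t => sum_f_R0 (fun k => Rabs (f k t)) N)
                 (fun t => Rabs (f (S N) t))).
      * apply Rplus_le_compat; [apply IH; intros; auto; apply Hf; lia|].
        apply abs_RInt_le; auto; apply cont_ex_RInt, Hf; lia.
      * apply cont_ex_RInt, C; lia.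
      * apply cont_ex_RInt, cont_abs, Hf; lia.
  - eapply Rle_trans; [apply Rle_abs|].
    apply RInt_abs_const; auto.
    intros t Ht; rewrite Rabs_pos_eq by (apply sum_nonneg; intros; apply Rabs_pos); auto.
Qed.

(** * The coefficient functions v n *)

(** The functions [p] and [v n] are only controlled on [[0, 1]].  Composing with this
    retraction gives integrands that are continuous on the whole line. *)
Definition clamp01 (t : R) : R := (Rabs t - Rabs (t - 1) + 1) / 2.

Lemma clamp01_range t : 0 <= clamp01 t <= 1.
Proof. unfold clamp01, Rabs; destruct (Rcase_abs t), (Rcase_abs (t - 1)); lra. Qed.

Lemma clamp01_id t : 0 <= t <= 1 -> clamp01 t = t.
Proof. unfold clamp01, Rabs; destruct (Rcase_abs t), (Rcase_abs (t - 1)); lra. Qed.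

Lemma cont_clamp01 : cont clamp01.
Proof.
  unfold clamp01, Rdiv; apply cont_mult, cont_const.
  apply cont_plus, cont_const; apply cont_minus; apply cont_abs.
  - apply cont_id.
  - apply cont_minus; [apply cont_id|apply cont_const].
Qed.

Lemma p_range t : 0 <= t <= 1 -> 1 <= p t <= 4.
Proof.
  intros Ht; unfold p; set (u := 1 - t ^ 2).
  assert (0 <= u <= 1) by (unfold u; nra).
  replace (4 - 6 * t ^ 2 + 4 * t ^ 4 - t ^ 6) with (1 + u + u ^ 2 + u ^ 3)
    by (unfold u; ring).
  assert (0 <= u ^ 2 <= 1) by nra.
  assert (0 <= u ^ 3 <= 1) by (simpl in *; nra).
  lra.
Qed.

Lemma cont_p : cont p.
Proof.
  unfold p; repeat first [apply cont_minus | apply cont_plus | apply cont_mult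
    | apply cont_const | apply cont_pow | apply cont_id].
Qed.

Definition avg (g : R -> R) (xi : R) : R :=
  / xi ^ 2 * RInt (fun t => t ^ 4 * g t) 0 xi.

(** At [0] the factor [t ^ 4] wins: the integral is [O(xi ^ 5)], so the quotient is
    [O(xi ^ 3)] in spite of the division by [xi ^ 2]. *)
Lemma cont_avg g : cont g -> cont (avg g).
Proof.
  intros Hg.
  assert (Hi : cont (fun t => t ^ 4 * g t)) by (apply cont_mult; auto; apply cont_pow, cont_id).
  intros xi; destruct (Req_dec xi 0) as [->|Hx].
  2:{ apply (continuous_mult (fun xi => / xi ^ 2)).
      - apply (ex_derive_continuous (fun xi => / xi ^ 2)).
        auto_derive; intros E; apply Hx; simpl in E; nra.
      - apply (continuous_RInt_1 (fun t => t ^ 4 * g t) 0 xi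
                 (fun z => RInt (fun t => t ^ 4 * g t) 0 z)).
        exists (mkposreal 1 Rlt_0_1); intros z _.
        apply (RInt_correct (fun t => t ^ 4 * g t)), cont_ex_RInt, Hi. }
  assert (E0 : avg g 0 = 0) by (unfold avg; rewrite RInt_point; apply Rmult_0_r).
  apply continuity_pt_filterlim; intros e He.
  destruct (proj1 (cont_pt g) Hg 0 1 Rlt_0_1) as [d [Hd Hb]].
  set (M := Rabs (g 0) + 1).
  assert (HM : 0 < M) by (unfold M; generalize (Rabs_pos (g 0)); lra).
  assert (B : forall t, Rabs t < d -> Rabs (g t) <= M).
  { intros t Ht; destruct (Req_dec t 0) as [->|Hn]; [unfold M; lra|].
    assert (X := Hb t); simpl in X; unfold Rdist, D_x, no_cond in X.
    rewrite Rminus_0_r in X.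
    assert (Rabs (g t - g 0) < 1) by auto.
    unfold M; replace (g t) with (g t - g 0 + g 0) by ring.
    eapply Rle_trans; [apply Rabs_triang|lra]. }
  exists (Rmin d (Rmin 1 (e / M))); split.
  - repeat apply Rmin_glb_lt; auto; [lra|now apply Rdiv_lt_0_compat].
  - simpl; unfold Rdist; intros t [[_ Hn] Ht]; rewrite E0, !Rminus_0_r in *.
    assert (H1 : Rabs t < d) by (eapply Rlt_le_trans; [apply Ht|apply Rmin_l]).
    assert (H2 : Rabs t < 1) by (eapply Rlt_le_trans; [apply Ht|];
      eapply Rle_trans; [apply Rmin_r|apply Rmin_l]).
    assert (H3 : Rabs t < e / M) by (eapply Rlt_le_trans; [apply Ht|];
      eapply Rle_trans; [apply Rmin_r|apply Rmin_r]).
    assert (Ha : 0 < Rabs t) by (apply Rabs_pos_lt; auto).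
    assert (S2 : forall s, s ^ 2 = Rabs s ^ 2) by (intros; rewrite pow2_abs; reflexivity).
    assert (I : Rabs (RInt (fun t => t ^ 4 * g t) 0 t) <= Rabs t * (Rabs t ^ 4 * M)).
    { assert (X : norm (RInt (fun t => t ^ 4 * g t) 0 t) <= Rabs (t - 0) * (Rabs t ^ 4 * M)).
      { apply (norm_RInt_le_const_abs (fun t => t ^ 4 * g t) 0 t).
        - intros s Hs.
          assert (Rabs s <= Rabs t).
          { unfold Rmin, Rmax in Hs; unfold Rabs;
            destruct (Rle_dec 0 t), (Rcase_abs s), (Rcase_abs t); lra. }
          change (Rabs (s ^ 4 * g s) <= Rabs t ^ 4 * M).
          rewrite Rabs_mult, <- RPow_abs.
          apply Rmult_le_compat; try apply Rabs_pos; [apply pow_le, Rabs_pos| |].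
          + apply pow_incr; split; auto; apply Rabs_pos.
          + apply B; lra.
        - apply (RInt_correct (fun t => t ^ 4 * g t)), cont_ex_RInt, Hi. }
      rewrite Rminus_0_r in X; exact X. }
    unfold avg; rewrite Rabs_mult, Rabs_inv, <- RPow_abs.
    assert (Ht2 : 0 < Rabs t ^ 2) by (apply pow_lt; auto).
    apply Rle_lt_trans with (/ Rabs t ^ 2 * (Rabs t * (Rabs t ^ 4 * M))).
    { apply Rmult_le_compat_l; auto; left; now apply Rinv_0_lt_compat. }
    replace (/ Rabs t ^ 2 * (Rabs t * (Rabs t ^ 4 * M))) with (Rabs t ^ 2 * (Rabs t * M))
      by (field; lra).
    assert (Rabs t * M < e).
    { apply Rmult_lt_reg_r with (/ M); [now apply Rinv_0_lt_compat|].
      rewrite Rmult_assoc, Rinv_r, Rmult_1_r; [exact H3|lra]. }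
    assert (Rabs t ^ 2 <= 1) by (simpl; nra).
    assert (0 < Rabs t * M) by (apply Rmult_lt_0_compat; auto).
    nra.
Qed.

Lemma v_upto_eq n j t : (j <= n)%nat -> v_upto n j t = v j t.
Proof.
  intros H; induction H as [|n H IH]; [reflexivity|].
  rewrite <- IH; simpl.
  destruct (Nat.eqb_spec j (S n)); [lia|reflexivity].
Qed.

(** Coefficients in [mu] of [q - p] *)
Definition qtail (t : R) (j : nat) : R := - v j t.

(** Coefficients in [mu] of [q ^ (3/2)] *)
Definition q32_coef (n : nat) (t : R) : R := pow32_coef (p t) (qtail t) n.

Lemma v_succ n xi : v (S n) xi = avg (q32_coef n) xi.
Proof.
  unfold v at 1; simpl; rewrite Nat.eqb_refl; unfold avg; f_equal.
  apply RInt_ext; intros t _; f_equal; apply pow32_coef_ext.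
  intros k Hk; unfold qtail; now rewrite v_upto_eq.
Qed.

Lemma cont_PS_pow (w : R -> nat -> R) m n :
  (forall k, (k <= n)%nat -> cont (fun t => w t k)) -> cont (fun t => PS_pow (w t) m n).
Proof.
  revert n; induction m as [|m IH]; intros n H; simpl; [apply cont_const|].
  unfold PS_mult; apply (cont_sum (fun k t => w t k * PS_pow (w t) m (n - k)%nat)).
  intros k Hk; apply cont_mult; auto.
  apply IH; intros; apply H; lia.
Qed.

Lemma cont_pow32 (q : R -> R) (w : R -> nat -> R) n :
  (forall t, 0 < q t) -> cont q ->
  (forall k, (k <= n)%nat -> cont (fun t => w t k)) ->
  cont (fun t => pow32_coef (q t) (w t) n).
Proof.
  intros Hp Hq Hw; unfold pow32_coef.
  apply (cont_sum (fun m t => gbinom (3 / 2) m * Rpower (q t) (3 / 2 - INR m)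
                              * PS_pow (w t) m n)).
  intros m _; apply cont_mult; [apply cont_mult|].
  - apply cont_const.
  - now apply cont_Rpower.
  - now apply cont_PS_pow.
Qed.

Definition q32_clamped (n : nat) (t : R) : R := q32_coef n (clamp01 t).

Lemma avg_ext g h xi :
  0 <= xi -> (forall t, 0 <= t <= xi -> g t = h t) -> avg g xi = avg h xi.
Proof.
  intros Hx H; unfold avg; f_equal; apply RInt_ext; intros t Ht.
  rewrite Rmin_left, Rmax_right in Ht by auto; rewrite H; lra.
Qed.

Lemma v_succ_clamp n xi : 0 <= xi <= 1 -> v (S n) xi = avg (q32_clamped n) xi.
Proof.
  intros Hx; rewrite v_succ; apply avg_ext; [lra|].
  intros t Ht; unfold q32_clamped; rewrite clamp01_id; [reflexivity|lra].
Qed.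

(** Strong induction: [v n] is an average of the previous [q32_coef], and the latter
    involves [v k] for [k <= n] only. *)
Lemma cont_v_q32 n :
  cont (fun t => v n (clamp01 t)) /\ cont (q32_clamped n).
Proof.
  induction n as [n IH] using (well_founded_induction Wf_nat.lt_wf).
  assert (Hv : cont (fun t => v n (clamp01 t))).
  { destruct n as [|n]; [exact (cont_const 0)|].
    apply (cont_ext (fun t => avg (q32_clamped n) (clamp01 t))).
    - intros t; symmetry; apply v_succ_clamp, clamp01_range.
    - apply (cont_comp clamp01 (avg (q32_clamped n))); [apply cont_clamp01|].
      apply cont_avg, IH; lia. }
  split; auto.
  apply (cont_pow32 (fun t => p (clamp01 t)) (fun t => qtail (clamp01 t))).
  - intros t; generalize (p_range _ (clamp01_range t)); lra.
  - apply (cont_comp clamp01 p); [apply cont_clamp01|apply cont_p].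
  - intros k Hk; apply cont_opp.
    destruct (Nat.eq_dec k n) as [->|]; auto; apply IH; lia.
Qed.

(** * Convergence of the expansion in mu *)

Lemma qtail_0 t : qtail t 0%nat = 0.
Proof. unfold qtail, v; simpl; ring. Qed.

(** Chosen to make [24 * v_radius = 1 / 2] *)
Definition v_radius : R := 1 / 48.

(** The coefficients up to [K] of the power only see the truncation of [q - p] at [K],
    for which the bound at order [K] holds at all orders. *)
Lemma q32_coef_wnorm K t :
  0 <= t <= 1 -> wnorm v_radius K (qtail t) <= 1 / 2 ->
  wnorm v_radius K (fun n => q32_coef n t) <= 24.
Proof.
  intros Ht H; unfold v_radius in *.
  rewrite (wnorm_ext _ _ _ (pow32_coef (p t) (PS_trunc K (qtail t)))).
  - apply pow32_bound.
    + now apply p_range.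
    + lra.
    + rewrite PS_trunc_le by lia; apply qtail_0.
    + apply wbound_trunc; auto; lra.
  - intros n Hn; apply pow32_coef_ext; intros k Hk; rewrite PS_trunc_le; auto; lia.
Qed.

(** Induction on [K], for all [xi] at once: the bound [1/2] at order [K] bounds
    [q ^ (3/2)] by [24] at order [K] ([q32_coef_wnorm]), and the recursion
    multiplies this by [v_radius = 1/48]. *)
Lemma qtail_bound xi : 0 <= xi <= 1 -> wbound v_radius (1 / 2) (qtail xi).
Proof.
  intros Hx K; revert xi Hx; induction K as [|K IH]; intros xi Hx.
  - unfold wnorm; simpl; rewrite qtail_0, Rabs_R0; lra.
  - rewrite wnorm_split, qtail_0, Rabs_R0, Rplus_0_l.
    enough (B : wnorm v_radius K (fun n => qtail xi (S n)) <= 24) by (unfold v_radius in *; lra).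
    assert (T : sum_f_R0 (fun n => Rabs (RInt (fun t => t ^ 4 * q32_clamped n t * v_radius ^ n) 0 xi)) K
                <= xi ^ 4 * 24 * (xi - 0)).
    { apply (sum_RInt_bound (fun n t => t ^ 4 * q32_clamped n t * v_radius ^ n)); [lra| |].
      - intros n _; apply cont_mult, cont_const.
        apply cont_mult; [apply cont_pow, cont_id|apply cont_v_q32].
      - intros t Ht.
        rewrite (sum_eq _ (fun n => Rabs (q32_coef n t) * v_radius ^ n * t ^ 4)).
        + rewrite <- scal_sum.
          apply Rmult_le_compat; [apply pow_le; lra|apply wnorm_nonneg; unfold v_radius; lra| |].
          * apply pow_incr; lra.
          * apply (q32_coef_wnorm K t); [lra|apply IH; lra].
        + intros n _; unfold q32_clamped; rewrite clamp01_id by lra.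
          rewrite !Rabs_mult, (Rabs_pos_eq (t ^ 4)) by (apply pow_le; lra).
          rewrite (Rabs_pos_eq (v_radius ^ n)) by (apply pow_le; unfold v_radius; lra); ring. }
    destruct (Req_dec xi 0) as [E|E].
    { unfold wnorm; rewrite (sum_eq _ (fun _ => 0)); [rewrite sum_cte; lra|].
      intros n _; unfold qtail; rewrite v_succ, E; unfold avg.
      rewrite RInt_point; unfold zero; simpl; rewrite Rmult_0_r, Ropp_0, Rabs_R0; ring. }
    assert (P : 0 < xi ^ 2) by (apply pow_lt; lra).
    unfold wnorm; rewrite (sum_eq _ (fun n =>
      Rabs (RInt (fun t => t ^ 4 * q32_clamped n t * v_radius ^ n) 0 xi) * / xi ^ 2)).
    + rewrite <- scal_sum.
      apply Rle_trans with (/ xi ^ 2 * (xi ^ 4 * 24 * (xi - 0))).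
      * apply Rmult_le_compat_l; auto; left; now apply Rinv_0_lt_compat.
      * replace (/ xi ^ 2 * (xi ^ 4 * 24 * (xi - 0))) with (24 * xi ^ 3) by (field; lra).
        assert (xi ^ 3 <= 1 ^ 3) by (apply pow_incr; lra); lra.
    + intros n _; unfold qtail; rewrite v_succ_clamp, Rabs_Ropp by auto; unfold avg.
      rewrite (RInt_mult_r (fun t => t ^ 4 * q32_clamped n t)).
      2:{ apply cont_mult; [apply cont_pow, cont_id|apply cont_v_q32]. }
      rewrite !Rabs_mult, Rabs_inv.
      rewrite (Rabs_pos_eq (v_radius ^ n)) by (apply pow_le; unfold v_radius; lra).
      rewrite (Rabs_pos_eq (xi ^ 2)) by lra; ring.
Qed.

Definition qsum (mu t : R) : R := p t + PSeries (qtail t) mu.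

Lemma v_radius_pos : 0 < v_radius.
Proof. unfold v_radius; lra. Qed.

Lemma qsum_ge mu t : 0 <= t <= 1 -> Rabs mu <= v_radius / 2 -> 1 / 2 <= qsum mu t.
Proof.
  intros Ht Hm; unfold qsum.
  assert (B : Rabs (PSeries (qtail t) mu) <= 1 / 2).
  { apply wbound_PSeries_abs with v_radius; [generalize v_radius_pos; lra|now apply qtail_bound]. }
  generalize (p_range t Ht); apply Rabs_le_between in B; lra.
Qed.

(** [q ^ (3/2)] along [[0, 1]], extended by constants *)
Definition q32 (mu t : R) : R := Rpower (qsum mu (clamp01 t)) (3 / 2).

Lemma q32_approx mu N t : Rabs mu <= v_radius / 2 ->
  Rabs (q32 mu t - sum_f_R0 (fun n => q32_clamped n t * mu ^ n) N) <= 24 * (/ 2) ^ N.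
Proof.
  intros Hm; assert (C := clamp01_range t).
  assert (E : q32 mu t = PSeries (fun n => q32_clamped n t) mu).
  { symmetry; apply is_pseries_unique.
    apply (pow32_value (p (clamp01 t)) v_radius).
    - now apply p_range.
    - apply v_radius_pos.
    - apply qtail_0.
    - now apply qtail_bound.
    - exact Hm. }
  rewrite E; apply (PSeries_tail v_radius); auto using v_radius_pos.
  intros K; apply q32_coef_wnorm; auto; now apply qtail_bound.
Qed.

Lemma cont_q32_partial_sum mu N : cont (fun t => sum_f_R0 (fun n => q32_clamped n t * mu ^ n) N).
Proof.
  apply (cont_sum (fun n t => q32_clamped n t * mu ^ n)).
  intros n _; apply cont_mult, cont_const; apply cont_v_q32.
Qed.

Lemma cont_q32 mu : Rabs mu <= v_radius / 2 -> cont (q32 mu).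
Proof.
  intros Hm; apply (cont_uniform_limit (fun N t => sum_f_R0 (fun n => q32_clamped n t * mu ^ n) N) _ (fun _ => 24)).
  - intros N; apply cont_q32_partial_sum.
  - intros N _ t _; now apply q32_approx.
Qed.

Lemma avg_sum (g : nat -> R -> R) mu N xi :
  (forall n, cont (g n)) ->
  sum_f_R0 (fun n => avg (g n) xi * mu ^ n) N
  = avg (fun t => sum_f_R0 (fun n => g n t * mu ^ n) N) xi.
Proof.
  intros Hg.
  assert (Hi : forall n, cont (fun t => t ^ 4 * (g n t * mu ^ n))).
  { intros n; apply cont_mult; [apply cont_pow, cont_id|].
    apply cont_mult; auto using cont_const. }
  assert (E : forall n, avg (g n) xi * mu ^ n = avg (fun t => g n t * mu ^ n) xi).
  { intros n; unfold avg; rewrite Rmult_assoc; f_equal.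
    rewrite <- RInt_mult_r by (apply cont_mult; auto; apply cont_pow, cont_id).
    apply RInt_ext; intros; apply Rmult_assoc. }
  induction N as [|N IH]; simpl; [apply E|].
  rewrite IH; change (mu * mu ^ N) with (mu ^ S N); rewrite E; unfold avg.
  rewrite <- Rmult_plus_distr_l; f_equal; symmetry.
  apply (is_RInt_unique (V := R_CompleteNormedModule)).
  apply (is_RInt_ext (fun t => plus (t ^ 4 * sum_f_R0 (fun n => g n t * mu ^ n) N)
     (t ^ 4 * (g (S N) t * mu ^ S N)))).
  - intros t _; symmetry; apply Rmult_plus_distr_l.
  - apply (is_RInt_plus (V := R_NormedModule)).
    + apply (RInt_correct (fun t => t ^ 4 * sum_f_R0 (fun n => g n t * mu ^ n) N)).
      apply cont_ex_RInt, cont_mult; [apply cont_pow, cont_id|].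
      apply (cont_sum (fun n t => g n t * mu ^ n)); intros; apply cont_mult; auto using cont_const.
    + apply (RInt_correct (fun t => t ^ 4 * (g (S N) t * mu ^ S N))), cont_ex_RInt, Hi.
Qed.

Lemma avg_diff_bound g h C xi :
  0 <= xi <= 1 -> cont g -> cont h -> (forall t, Rabs (g t - h t) <= C) ->
  xi ^ 2 * Rabs (avg g xi - avg h xi) <= C.
Proof.
  intros Hx Hg Hh HC.
  assert (P4 : cont (fun t => t ^ 4)) by apply cont_pow, cont_id.
  assert (C0 : 0 <= C) by (eapply Rle_trans; [apply Rabs_pos|apply (HC 0)]).
  destruct (Req_dec xi 0) as [->|Hn].
  { simpl; rewrite !Rmult_0_l; auto. }
  assert (P : 0 < xi ^ 2) by (apply pow_lt; lra).
  rewrite <- (Rabs_pos_eq (xi ^ 2)), <- Rabs_mult by lra.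
  unfold avg.
  replace (xi ^ 2 * (/ xi ^ 2 * RInt (fun t => t ^ 4 * g t) 0 xi
     - / xi ^ 2 * RInt (fun t => t ^ 4 * h t) 0 xi))
    with (RInt (fun t => t ^ 4 * g t) 0 xi - RInt (fun t => t ^ 4 * h t) 0 xi)
    by (field; lra).
  assert (E : RInt (fun t => t ^ 4 * g t) 0 xi - RInt (fun t => t ^ 4 * h t) 0 xi
    = RInt (fun t => t ^ 4 * (g t - h t)) 0 xi).
  { symmetry; apply (is_RInt_unique (V := R_CompleteNormedModule)).
    apply (is_RInt_ext (fun t => minus (t ^ 4 * g t) (t ^ 4 * h t))).
    - intros t _; unfold minus, plus, opp; simpl; ring.
    - apply (is_RInt_minus (V := R_NormedModule)).
      + apply (RInt_correct (fun t => t ^ 4 * g t)), cont_ex_RInt, cont_mult; auto.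
      + apply (RInt_correct (fun t => t ^ 4 * h t)), cont_ex_RInt, cont_mult; auto. }
  rewrite E; clear E.
  apply Rle_trans with (C * (xi - 0)).
  - apply RInt_abs_const; [lra|apply cont_mult; auto; now apply cont_minus|].
    intros t Ht; rewrite Rabs_mult, <- (Rmult_1_l C).
    apply Rmult_le_compat; try apply Rabs_pos; auto.
    rewrite Rabs_pos_eq by (apply pow_le; lra).
    rewrite <- (pow1 4); apply pow_incr; lra.
  - nra.
Qed.

(** Sum of the recursion for [v].  The partial sums of [q ^ (3/2)] converge at the rate
    [2 ^ -N] uniformly in [t], so both sides differ by [O(2 ^ -N)] for every [N]. *)
Lemma qsum_integral mu xi :
  Rabs mu <= v_radius / 2 -> 0 <= xi <= 1 ->
  xi ^ 2 * qsum mu xi = xi ^ 2 * p xi - mu * RInt (fun t => t ^ 4 * q32 mu t) 0 xi.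
Proof.
  intros Hm Hx.
  destruct (Req_dec xi 0) as [->|Hn].
  { rewrite RInt_point; change zero with 0; ring. }
  assert (P : 0 < xi ^ 2) by (apply pow_lt; lra).
  assert (V := v_radius_pos).
  set (D := PSeries (qtail xi) mu + mu * avg (q32 mu) xi).
  assert (D0 : xi ^ 2 * D = 0).
  { apply eq_0_of_geometric_bound with (1 / 2 + 24); intros N.
    assert (T := PSeries_tail v_radius (1 / 2) (qtail xi) mu (S N) V Hm (qtail_bound xi Hx)).
    rewrite decomp_sum, qtail_0, Rmult_0_l, Rplus_0_l in T by lia; cbn [Nat.pred] in T.
    rewrite (sum_eq _ (fun n => (avg (q32_clamped n) xi * mu ^ n) * (- mu))) in T.
    2:{ intros n _; unfold qtail; rewrite v_succ_clamp by auto; simpl; ring. }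
    rewrite <- scal_sum, avg_sum in T by (intros; apply cont_v_q32).
    assert (B := avg_diff_bound (q32 mu)
      (fun t => sum_f_R0 (fun n => q32_clamped n t * mu ^ n) N) (24 * (/ 2) ^ N) xi Hx
      (cont_q32 mu Hm) (cont_q32_partial_sum mu N) (fun t => q32_approx mu N t Hm)).
    set (a := avg (fun t => sum_f_R0 (fun n => q32_clamped n t * mu ^ n) N) xi) in *.
    replace (xi ^ 2 * D) with (xi ^ 2 * (PSeries (qtail xi) mu - - mu * a)
       + mu * (xi ^ 2 * (avg (q32 mu) xi - a))) by (unfold D; ring).
    eapply Rle_trans; [apply Rabs_triang|].
    rewrite Rmult_plus_distr_r; apply Rplus_le_compat.
    - rewrite Rabs_mult, (Rabs_pos_eq (xi ^ 2)) by lra.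
      apply Rle_trans with (1 * (1 / 2 * (/ 2) ^ S N)).
      + apply Rmult_le_compat; auto; try lra; [apply Rabs_pos|].
        rewrite <- (pow1 2); apply pow_incr; lra.
      + assert (0 < (/ 2) ^ N) by (apply pow_lt; lra); simpl; lra.
    - rewrite !Rabs_mult, (Rabs_pos_eq (xi ^ 2)) by lra.
      rewrite <- (Rmult_1_l (24 * _)).
      apply Rmult_le_compat; auto; [apply Rabs_pos| |unfold v_radius in *; lra].
      apply Rmult_le_pos; [lra|apply Rabs_pos]. }
  assert (I : RInt (fun t => t ^ 4 * q32 mu t) 0 xi = xi ^ 2 * avg (q32 mu) xi)
    by (unfold avg; rewrite <- Rmult_assoc, Rinv_r, Rmult_1_l by lra; reflexivity).
  rewrite I; unfold qsum; unfold D in D0; lra.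
Qed.

Lemma crossing_value mu :
  Rabs mu <= v_radius / 2 -> PSeries crossing_coef mu = qsum mu 1.
Proof.
  intros Hm; unfold qsum.
  assert (E : p 1 = 1) by (unfold p; ring); rewrite E.
  rewrite (PSeries_ext _ (PS_plus PS_unit (qtail 1))), PSeries_plus.
  - now rewrite (is_pseries_unique _ _ _ (is_pseries_unit mu)).
  - exists 1; apply is_pseries_unit.
  - exists (PSeries (qtail 1) mu); apply (wbound_is_pseries v_radius (1 / 2)).
    + generalize v_radius_pos; lra.
    + apply qtail_bound; lra.
  - intros [|n].
    + change (1 = 1 + qtail 1 0); rewrite qtail_0; ring.
    + change (- v (S n) 1 = 0 + - v (S n) 1); ring.
Qed.

(** Here [G] is [xi ^ 2 * q].  Defining it by the integral makes it differentiable across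
    [xi = 1], where the arcs of two quadrants meet. *)
Lemma quarter_orbit mu :
  Rabs mu <= v_radius / 2 ->
  exists G : R -> R,
    cont G /\ G 0 = 0 /\ G 1 = PSeries crossing_coef mu /\
    forall xi, 0 < xi <= 1 ->
      xi ^ 2 / 2 <= G xi /\
      is_derive G xi (8 * xi * (1 - xi ^ 2) ^ 3 - mu * xi * sqrt (G xi) ^ 3).
Proof.
  intros Hm.
  assert (Ci : cont (fun t => t ^ 4 * q32 mu t))
    by (apply cont_mult; [apply cont_pow, cont_id|now apply cont_q32]).
  set (I := fun xi => RInt (fun t => t ^ 4 * q32 mu t) 0 xi).
  assert (DI : forall xi, is_derive I xi (xi ^ 4 * q32 mu xi)).
  { intros xi; apply (is_derive_RInt (fun t => t ^ 4 * q32 mu t) I 0 xi); auto.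
    exists (mkposreal 1 Rlt_0_1); intros z _.
    apply (RInt_correct (fun t => t ^ 4 * q32 mu t)), cont_ex_RInt, Ci. }
  set (G := fun xi => xi ^ 2 * p xi - mu * I xi).
  assert (DG : forall xi, is_derive G xi
     (8 * xi * (1 - xi ^ 2) ^ 3 - mu * (xi ^ 4 * q32 mu xi))).
  { intros xi; unfold G.
    apply (is_derive_minus (fun xi => xi ^ 2 * p xi) (fun xi => mu * I xi)).
    - unfold p; auto_derive; auto; ring.
    - apply (is_derive_scal I); auto. }
  assert (GQ : forall xi, 0 <= xi <= 1 -> G xi = xi ^ 2 * qsum mu xi)
    by (intros; unfold G, I; now rewrite qsum_integral).
  exists G; split; [|split; [|split; [|intros xi Hxi; split]]].
  - intros xi; apply (ex_derive_continuous G); eexists; apply DG.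
  - rewrite GQ by lra; ring.
  - rewrite GQ, crossing_value by (auto; lra); ring.
  - rewrite GQ by lra; assert (Q := qsum_ge mu xi); nra.
  - refine (is_derive_eq _ _ _ _ (DG xi) _).
    assert (Q : 1 / 2 <= qsum mu xi) by (apply qsum_ge; auto; lra).
    rewrite GQ, sqrt_mult, sqrt_pow2 by nra.
    unfold q32; rewrite clamp01_id, Rpower_32_sqrt by lra; ring.
Qed.

(** * From one axis to the next *)

Definition kappa : R := Rpower 2 (3 / 2).

Lemma kappa_sqrt : kappa = 2 * sqrt 2.
Proof.
  unfold kappa; rewrite Rpower_32_sqrt by lra; simpl.
  rewrite Rmult_1_r, sqrt_sqrt; lra.
Qed.

Lemma kappa_sqr : kappa ^ 2 = 8.
Proof.
  rewrite kappa_sqrt; replace ((2 * sqrt 2) ^ 2) with (4 * (sqrt 2 * sqrt 2)) by ring.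
  rewrite sqrt_sqrt; lra.
Qed.

Lemma kappa_range : 0 < kappa < 3.
Proof.
  assert (0 < kappa) by (unfold kappa, Rpower; apply exp_pos).
  split; auto; generalize kappa_sqr; nra.
Qed.

(** The same formula serves the arc from [(e, 0)] with [e > 0] and the backward arc from
    [(e, 0)] with [e < 0]; the lower bound is what keeps [Y] away from [0]
    except at [X = e]. *)
Lemma axis_arc (e : R) :
  e <> 0 -> Rabs (kappa * e ^ 3) <= v_radius / 2 ->
  exists F : R -> R,
    cont F /\ F e = 0 /\ F 0 = e ^ 4 / 2 * PSeries crossing_coef (kappa * e ^ 3) /\
    forall X, 0 <= X / e < 1 ->
      e ^ 4 / 4 * (1 - X / e) <= F X /\
      is_derive F X (- 2 * X ^ 3 + 2 * sqrt (F X) ^ 3).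
Proof.
  intros He Hm.
  destruct (quarter_orbit _ Hm) as [G [CG [G0 [G1 HG]]]].
  set (xi := fun X => sqrt (1 - X / e)).
  assert (Pe : 0 < e ^ 4).
  { replace (e ^ 4) with ((e ^ 2) ^ 2) by ring.
    assert (0 < e ^ 2) by (rewrite <- Rsqr_pow2; now apply Rlt_0_sqr).
    now apply pow_lt. }
  exists (fun X => e ^ 4 / 2 * G (xi X)); split; [|split; [|split]].
  - apply cont_mult; [apply cont_const|].
    apply (cont_comp xi G); auto; unfold xi; apply cont_sqrt.
    apply cont_minus; [apply cont_const|]; unfold Rdiv.
    apply cont_mult; [apply cont_id|apply cont_const].
  - unfold xi; replace (1 - e / e) with 0 by (field; auto).
    rewrite sqrt_0, G0; ring.
  - unfold xi; replace (1 - 0 / e) with 1 by (field; auto).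
    now rewrite sqrt_1, G1.
  - intros X HX.
    assert (Hxi : 0 < xi X <= 1).
    { unfold xi; split; [apply sqrt_lt_R0; lra|].
      rewrite <- sqrt_1 at 2; apply sqrt_le_1; lra. }
    assert (Hxi2 : xi X ^ 2 = 1 - X / e) by (unfold xi; apply pow2_sqrt; lra).
    destruct (HG (xi X) Hxi) as [HG1 HG2].
    assert (HG0 : 0 <= G (xi X)) by (assert (0 < xi X ^ 2) by (apply pow_lt; lra); lra).
    split.
    + rewrite <- Hxi2; apply (Rmult_le_compat_l (e ^ 4 / 2)) in HG1; lra.
    + assert (D1 : is_derive xi X (- / (2 * e * xi X))).
      { unfold xi; auto_derive.
        - unfold Rdiv in HX; lra.
        - change (sqrt (1 - X / e)) with (xi X).
          change (sqrt (1 + - (X * / e))) with (xi X); field; lra. }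
      assert (D2 := is_derive_comp G xi X _ _ HG2 D1).
      assert (D3 := is_derive_scal _ _ (e ^ 4 / 2) _ D2).
      refine (is_derive_eq _ _ _ _ D3 _).
      set (s := sqrt (G (xi X))) in *.
      set (r := sqrt 2).
      assert (Hr : 0 < r) by (apply sqrt_lt_R0; lra).
      assert (Hr2 : r * r = 2) by (apply sqrt_sqrt; lra).
      assert (Es : sqrt (e ^ 4 / 2 * G (xi X)) = e ^ 2 / r * s).
      { rewrite sqrt_mult by lra; fold s; f_equal.
        unfold Rdiv; rewrite sqrt_mult, sqrt_inv by lra; fold r; f_equal.
        replace (e ^ 4) with ((e ^ 2) ^ 2) by ring.
        apply sqrt_pow2, pow2_ge_0. }
      rewrite Es, kappa_sqrt; fold r.
      change (e ^ 4 / 2 * (- / (2 * e * xi X) *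
        (8 * xi X * (1 - xi X ^ 2) ^ 3 - 2 * r * e ^ 3 * xi X * s ^ 3))
        = - 2 * X ^ 3 + 2 * (e ^ 2 / r * s) ^ 3).
      replace (1 - xi X ^ 2) with (X / e) by lra.
      transitivity (- 2 * X ^ 3 + r / 2 * e ^ 6 * s ^ 3); [field; lra|].
      f_equal.
      replace (2 * (e ^ 2 / r * s) ^ 3) with (2 / (r * r) / r * e ^ 6 * s ^ 3)
        by (field; lra).
      rewrite Hr2; replace (r / 2) with (r * r / 2 / r) by (field; lra).
      rewrite Hr2; field; lra.
Qed.

Lemma diff_cubes_sign y r : 0 <= y -> 0 <= r -> 0 <= (y ^ 2 - r ^ 2) * (y ^ 3 - r ^ 3).
Proof.
  intros Hy Hr.
  replace ((y ^ 2 - r ^ 2) * (y ^ 3 - r ^ 3))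
    with ((y - r) ^ 2 * ((y + r) * (y ^ 2 + y * r + r ^ 2))) by ring.
  apply Rmult_le_pos; [apply pow2_ge_0|].
  apply Rmult_le_pos; [lra|nra].
Qed.

(** The derivative of [(Y ^ 2 - F X) ^ 2] is
    [- 4 * Y * (Y ^ 2 - F X) * (Y ^ 3 - F X ^ (3/2)) <= 0]. *)
Lemma stays_on_arc (x y F : R -> R) (a b : R) :
  a < b ->
  (forall t, a <= t <= b ->
     is_derive x t (- y t) /\ is_derive y t (x t ^ 3 - y t ^ 3)) ->
  (forall t, a <= t <= b -> 0 <= y t /\ 0 <= F (x t)) ->
  cont F ->
  (forall t, a < t < b -> is_derive F (x t) (- 2 * x t ^ 3 + 2 * sqrt (F (x t)) ^ 3)) ->
  y a ^ 2 = F (x a) -> y b ^ 2 = F (x b).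
Proof.
  intros Hab Hs Hp CF HF Ha.
  set (W := fun t => y t ^ 2 - F (x t)).
  set (dW := fun t => - 2 * y t * (y t ^ 3 - sqrt (F (x t)) ^ 3)).
  destruct (MVT_gen (fun t => W t ^ 2) a b (fun t => 2 * W t * dW t)) as [c [Hc E]].
  - intros t; rewrite Rmin_left, Rmax_right by lra; intros Ht.
    destruct (Hs t) as [Hx Hy]; [lra|]; specialize (HF t Ht).
    assert (D1 := is_derive_comp F x t _ _ HF Hx).
    assert (D2 := is_derive_pow y 2 t _ Hy).
    assert (D3 := is_derive_minus _ _ _ _ _ D2 D1).
    assert (D4 := is_derive_pow _ 2 _ _ D3).
    refine (is_derive_eq _ _ _ _ D4 _).
    unfold W, dW, minus, plus, opp, scal; simpl; unfold mult; simpl; ring.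
  - intros t; rewrite Rmin_left, Rmax_right by lra; intros Ht.
    destruct (Hs t Ht) as [Hx Hy].
    apply continuity_pt_filterlim.
    assert (Cx : continuous x t) by (apply (ex_derive_continuous x); eexists; apply Hx).
    assert (Cy : continuous y t) by (apply (ex_derive_continuous y); eexists; apply Hy).
    assert (CW : continuous W t).
    { apply (continuous_minus (fun t => y t ^ 2) (fun t => F (x t))).
      - apply (continuous_comp y (fun u => u ^ 2)); auto; apply (cont_pow (fun u => u)), cont_id.
      - apply (continuous_comp x F); auto. }
    apply (continuous_comp W (fun u => u ^ 2)); auto; apply (cont_pow (fun u => u)), cont_id.
  - rewrite Rmin_left, Rmax_right in Hc by lra.
    assert (Wa : W a = 0) by (unfold W; lra).
    assert (N : 2 * W c * dW c <= 0).
    { destruct (Hp c Hc) as [Py PF].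
      assert (S := diff_cubes_sign (y c) (sqrt (F (x c))) Py (sqrt_pos _)).
      rewrite pow2_sqrt in S by auto.
      unfold W, dW; nra. }
    rewrite Wa in E.
    assert (W b ^ 2 <= 0) by nra.
    assert (W b = 0) by nra.
    unfold W in *; lra.
Qed.

Lemma first_zero (f : R -> R) (d T : R) :
  0 < d -> 0 < T -> (forall t, 0 < t -> continuity_pt f t) ->
  (forall t, 0 < t <= d -> 0 < f t) -> f T <= 0 ->
  exists t1, 0 < t1 /\ f t1 = 0 /\ forall t, 0 < t < t1 -> 0 < f t.
Proof.
  intros Hd HT Cf Hpos HfT.
  set (E := fun t => forall s, 0 < s <= t -> 0 < f s).
  destruct (completeness E) as [t1 [U L]].
  - exists T; intros t Ht; destruct (Rle_dec t T) as [|n]; auto.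
    assert (0 < f T) by (apply Ht; lra); lra.
  - exists d; exact Hpos.
  - assert (Hd1 : d <= t1) by (apply U; exact Hpos).
    assert (B : forall t, 0 < t < t1 -> 0 < f t).
    { intros t Ht; destruct (Rlt_dec 0 (f t)) as [|n]; auto; exfalso.
      assert (t1 <= t); [|lra].
      apply L; intros s Hs; destruct (Rle_dec s t) as [|m]; auto.
      exfalso; apply n, Hs; lra. }
    exists t1; split; [lra|split; auto].
    assert (C1 := Cf t1 ltac:(lra)).
    destruct (Rtotal_order (f t1) 0) as [N|[Z|P]]; auto; exfalso.
    + destruct (C1 (- f t1)) as [a [Ha Hb]]; [lra|].
      set (s := Rmax (t1 / 2) (t1 - a / 2)).
      assert (S1 : t1 / 2 <= s) by apply Rmax_l.
      assert (S2 : t1 - a / 2 <= s) by apply Rmax_r.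
      assert (S3 : s < t1) by (apply Rmax_lub_lt; lra).
      assert (X := Hb s); simpl in X; unfold Rdist, D_x, no_cond in X.
      assert (Y : Rabs (f s - f t1) < - f t1).
      { apply X; split; [split; auto; lra|].
        apply Rabs_def1; lra. }
      apply Rabs_def2 in Y; specialize (B s); lra.
    + destruct (C1 (f t1)) as [a [Ha Hb]]; [lra|].
      assert (t1 + a / 2 <= t1); [|lra].
      apply U; intros s Hs.
      destruct (Rlt_dec s t1); [apply B; lra|].
      destruct (Req_dec s t1) as [->|n1]; auto.
      assert (X := Hb s); simpl in X; unfold Rdist, D_x, no_cond in X.
      assert (Y : Rabs (f s - f t1) < f t1).
      { apply X; split; [split; auto; lra|].
        apply Rabs_def1; lra. }
      apply Rabs_def2 in Y; lra.
Qed.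

(** As long as [Y > 0], [X] decreases.  It must become negative, because in the first
    quadrant [Y] stays above a positive constant along the arc; afterwards [Y' <= X ^ 3]
    brings [Y] down to [0] in finite time.  At this first zero of [Y] the second arc
    forces [X = - Z]: its ordinate vanishes nowhere else. *)
Lemma half_turn (eps Z : R) (x y : R -> R) :
  0 < eps -> 0 < Z ->
  Rabs (kappa * eps ^ 3) <= v_radius / 2 -> Rabs (kappa * (- Z) ^ 3) <= v_radius / 2 ->
  Z ^ 4 * PSeries crossing_coef (kappa * (- Z) ^ 3)
  = eps ^ 4 * PSeries crossing_coef (kappa * eps ^ 3) ->
  is_solution eps x y ->
  exists t1, 0 < t1 /\ y t1 = 0 /\ x t1 = - Z /\ forall t, 0 < t < t1 -> 0 < y t.
Proof.
  intros He HZ Hme HmZ HQ [x0 [y0 Hs]].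
  destruct (axis_arc eps ltac:(lra) Hme) as [F [CF [Fe [F0 HF]]]].
  destruct (axis_arc (- Z) ltac:(lra) HmZ) as [H [CH [He' [H0 HH]]]].
  assert (Pe : 0 < eps ^ 4 / 4) by (assert (0 < eps ^ 4) by (apply pow_lt; auto); lra).
  assert (PZ : 0 < (- Z) ^ 4 / 4).
  { replace ((- Z) ^ 4) with (Z ^ 4) by ring.
    assert (0 < Z ^ 4) by (apply pow_lt; auto); lra. }
  assert (Dx : forall t, 0 <= t -> derivable_pt_lim x t (- y t))
    by (intros t Ht; apply is_derive_Reals, Hs, Ht).
  assert (Dy : forall t, 0 <= t -> derivable_pt_lim y t (x t ^ 3 - y t ^ 3))
    by (intros t Ht; apply is_derive_Reals, Hs, Ht).
  assert (Cx : forall t, 0 <= t -> continuity_pt x t).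
  { intros t Ht; apply derivable_continuous_pt; eexists; apply Dx, Ht. }
  assert (Cy : forall t, 0 <= t -> continuity_pt y t).
  { intros t Ht; apply derivable_continuous_pt; eexists; apply Dy, Ht. }
  assert (Dec : forall a b, 0 <= a -> a < b -> (forall t, a < t < b -> 0 < y t) -> x b < x a).
  { intros a b Ha Hab Hy.
    destruct (MVT_cor2 x (fun t => - y t) a b Hab) as [c [E Hc]];
      [intros; apply Dx; lra|].
    specialize (Hy c Hc); nra. }
  assert (Start : exists d, 0 < d /\ forall t, 0 < t <= d -> 0 < y t).
  { assert (P : 0 < eps ^ 3) by (apply pow_lt; auto).
    destruct (Dy 0 (Rle_refl 0) (eps ^ 3)) as [d Hd]; [auto|].
    exists (d / 2); split; [destruct d; simpl; lra|].
    intros t Ht; 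
    assert (A := Hd t).
    rewrite Rplus_0_l, x0, y0 in A.
    assert (B : Rabs ((y t - 0) / t - (eps ^ 3 - 0 ^ 3)) < eps ^ 3).
    { apply A; [lra|]; rewrite Rabs_pos_eq by lra; destruct d; simpl in *; lra. }
    apply Rabs_def2 in B.
    replace (y t) with ((y t - 0) / t * t) by (field; lra).
    apply Rmult_lt_0_compat; lra. }
  destruct Start as [d [Hd Hdy]].
  assert (Q1 : forall T, 0 < T -> (forall t, 0 < t < T -> 0 < y t) -> 0 <= y T ->
            0 <= x T -> y T ^ 2 = F (x T)).
  { intros T HT Hy HyT HxT.
    assert (R : forall t, 0 < t <= T -> 0 <= x t / eps < 1).
    { intros t Ht.
      assert (x t < x 0) by (apply Dec; [lra|lra|intros; apply Hy; lra]).
      assert (x T <= x t).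
      { destruct (Req_dec t T) as [->|]; [lra|].
        left; apply Dec; [lra|lra|intros; apply Hy; lra]. }
      split; [apply Rdiv_le_0_compat; lra|].
      apply Rmult_lt_reg_r with eps; auto; unfold Rdiv; rewrite Rmult_assoc, Rinv_l; lra. }
    apply (stays_on_arc x y F 0 T HT); auto.
    - intros t Ht; apply Hs; lra.
    - intros t Ht; destruct (Req_dec t 0) as [->|].
      + rewrite x0, y0, Fe; lra.
      + split.
        * destruct (Req_dec t T) as [->|]; auto; left; apply Hy; lra.
        * destruct (HF (x t)) as [HF1 _]; [apply R; lra|].
          assert (0 <= x t / eps < 1) by (apply R; lra); nra.
    - intros t Ht; apply HF, R; lra.
    - rewrite x0, y0, Fe; ring. }
  (* If [y] never vanished again, then either [x] becomes negative and [y' <= x ^ 3]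
     stays below a negative constant, or [x] stays nonnegative although [x' = - y] is
     bounded away from [0]; neither is possible. *)
  assert (Back : exists T, 0 < T /\ y T <= 0).
  { destruct (Classical_Prop.classic (exists T, 0 < T /\ y T <= 0)) as [|N]; auto.
    exfalso.
    assert (Py : forall t, 0 < t -> 0 < y t).
    { intros t Ht; destruct (Rlt_dec 0 (y t)) as [|n]; auto; exfalso.
      apply N; exists t; lra. }
    assert (X1 : x 1 < eps) by (rewrite <- x0; apply Dec; try lra; intros; apply Py; lra).
    destruct (Classical_Prop.classic (exists T, 0 < T /\ x T < 0)) as [[T [HT HxT]]|M].
    - assert (P3 : 0 < - x T ^ 3) by (replace (- x T ^ 3) with ((- x T) ^ 3) by ring;
        apply pow_lt; lra).
      set (k := - x T ^ 3) in *.
      assert (PyT := Py T HT).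
      assert (Pk : 0 < y T / k) by (now apply Rdiv_lt_0_compat).
      destruct (MVT_cor2 y (fun t => x t ^ 3 - y t ^ 3) T (T + y T / k)) as [c [E Hc]];
        [lra|intros; apply Dy; lra|].
      assert (x c < x T) by (apply Dec; try lra; intros; apply Py; lra).
      assert (k < (- x c) ^ 3).
      { assert (Q : 0 < (x T - x c) * ((- x c) ^ 2 + (- x c) * (- x T) + (- x T) ^ 2)).
        { apply Rmult_lt_0_compat; [lra|].
          assert (0 < (- x c) * (- x T)) by (apply Rmult_lt_0_compat; lra).
          generalize (pow2_ge_0 (- x c)) (pow2_ge_0 (- x T)); lra. }
        unfold k; lra. }
      assert (0 < y c ^ 3) by (apply pow_lt, Py; lra).
      assert (0 < y (T + y T / k)) by (apply Py; lra).
      assert (B : (x c ^ 3 - y c ^ 3) * (T + y T / k - T) < - k * (y T / k)) by nra.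
      replace (- k * (y T / k)) with (- y T) in B by (field; lra).
      lra.
    - assert (Px : forall t, 0 < t -> 0 <= x t).
      { intros t Ht; destruct (Rle_dec 0 (x t)) as [|n]; auto; exfalso.
        apply M; exists t; lra. }
      set (m := eps ^ 4 / 4 * (1 - x 1 / eps)).
      assert (Pm : 0 < m).
      { apply Rmult_lt_0_compat; auto.
        assert (x 1 / eps < 1); [|lra].
        apply Rmult_lt_reg_r with eps; auto; unfold Rdiv; rewrite Rmult_assoc, Rinv_l; lra. }
      assert (Pr : 0 < sqrt m) by (now apply sqrt_lt_R0).
      assert (Lb : forall t, 1 < t -> sqrt m <= y t).
      { intros t Ht.
        assert (Xt : x t < x 1) by (apply Dec; try lra; intros; apply Py; lra).
        assert (P0 := Px t ltac:(lra)).
        assert (Y0 := Py t ltac:(lra)).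
        assert (E : y t ^ 2 = F (x t)) by (apply Q1; try lra; intros; apply Py; lra).
        assert (A : x t / eps <= x 1 / eps < 1).
        { split.
          - apply Rmult_le_compat_r; [left; now apply Rinv_0_lt_compat|lra].
          - apply Rmult_lt_reg_r with eps; auto; unfold Rdiv; rewrite Rmult_assoc, Rinv_l; lra. }
        destruct (HF (x t)) as [HF1 _]; [split; [apply Rdiv_le_0_compat|]; lra|].
        assert (m <= y t ^ 2) by (rewrite E; unfold m; nra).
        rewrite <- (sqrt_pow2 (y t)) by lra; apply sqrt_le_1; try lra; apply pow2_ge_0. }
      assert (X0 := Px 1 ltac:(lra)).
      assert (Pq : 0 < (x 1 + 1) / sqrt m) by (apply Rdiv_lt_0_compat; lra).
      destruct (MVT_cor2 x (fun t => - y t) 1 (1 + (x 1 + 1) / sqrt m)) as [c [E Hc]];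
        [lra|intros; apply Dx; lra|].
      assert (B := Lb c ltac:(lra)).
      assert (P1 := Px (1 + (x 1 + 1) / sqrt m) ltac:(lra)).
      assert (A : y c * ((x 1 + 1) / sqrt m) >= sqrt m * ((x 1 + 1) / sqrt m)) by nra.
      replace (sqrt m * ((x 1 + 1) / sqrt m)) with (x 1 + 1) in A by (field; lra).
      lra. }
  destruct Back as [T [HT HyT]].
  destruct (first_zero y d T Hd HT) as [t1 [Ht1 [Hy1 Hpos]]]; auto.
  { intros; apply Cy; lra. }
  assert (Neg : x t1 < 0).
  { destruct (Rlt_dec (x t1) 0) as [|n]; auto; exfalso.
    assert (E : y t1 ^ 2 = F (x t1)) by (apply Q1; auto; lra).
    assert (X1 : x t1 < eps) by (rewrite <- x0; apply Dec; auto; lra).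
    assert (A : 0 <= x t1 / eps < 1).
    { split; [apply Rdiv_le_0_compat; lra|].
      apply Rmult_lt_reg_r with eps; auto; unfold Rdiv; rewrite Rmult_assoc, Rinv_l; lra. }
    destruct (HF _ A) as [HF1 _]; rewrite <- E, Hy1 in HF1; nra. }
  assert (IV : forall a c, 0 <= a < t1 -> x t1 < c -> c < x a ->
            exists t, a < t < t1 /\ x t = c).
  { intros a c Ha H1 H2.
    destruct (IVT_interv (fun t => c - x t) a t1) as [t [Ht E]]; try lra.
    - intros t Ht; apply continuity_pt_minus; [apply continuity_pt_const; intros ? ?; auto|].
      apply Cx; lra.
    - assert (t <> a) by (intros ->; lra).
      assert (t <> t1) by (intros ->; lra).
      exists t; split; lra. }
  destruct (IV 0 0) as [t0 [Ht0 X0]]; try lra.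
  assert (E0 : y t0 ^ 2 = H (x t0)).
  { rewrite (Q1 t0), X0, F0, H0; try lra.
    - intros; apply Hpos; lra.
    - left; apply Hpos; lra. }
  assert (Q2 : forall s, t0 < s <= t1 -> - Z <= x s -> y s ^ 2 = H (x s)).
  { intros s Hst HxT.
    assert (R : forall t, t0 <= t < s -> 0 <= x t / - Z < 1).
    { intros t Ht.
      assert (x t <= 0).
      { rewrite <- X0; destruct (Req_dec t t0) as [->|]; [lra|].
        left; apply Dec; [lra|lra|intros; apply Hpos; lra]. }
      assert (x s < x t) by (apply Dec; [lra|lra|intros; apply Hpos; lra]).
      replace (x t / - Z) with (- x t / Z) by (field; lra).
      split; [apply Rdiv_le_0_compat; lra|].
      apply Rmult_lt_reg_r with Z; auto; unfold Rdiv; rewrite Rmult_assoc, Rinv_l; lra. }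
    apply (stays_on_arc x y H t0 s); auto; try lra.
    - intros t Ht; apply Hs; lra.
    - intros t Ht; split.
      + destruct (Req_dec t t1) as [->|]; [lra|left; apply Hpos; lra].
      + destruct (Req_dec (x t) (- Z)) as [->|]; [lra|].
        assert (A : 0 <= x t / - Z < 1).
        { destruct (Req_dec t s) as [->|]; [|apply R; lra].
          assert (x s < x t0) by (apply Dec; [lra|lra|intros; apply Hpos; lra]).
          replace (x s / - Z) with (- x s / Z) by (field; lra).
          split; [apply Rdiv_le_0_compat; lra|].
          apply Rmult_lt_reg_r with Z; auto; unfold Rdiv; rewrite Rmult_assoc, Rinv_l; lra. }
        destruct (HH (x t) A) as [HF1 _]; nra.
    - intros t Ht; apply HH, R; lra. }
  exists t1; split; [auto|split; [auto|split; auto]].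
  destruct (Rtotal_order (x t1) (- Z)) as [L|[E|G]]; auto; exfalso.
  - destruct (IV t0 (- Z)) as [t [Ht E]]; try lra.
    assert (Y := Q2 t ltac:(lra) ltac:(lra)).
    rewrite E, He' in Y.
    assert (P := Hpos t ltac:(lra)); nra.
  - assert (Y := Q2 t1 ltac:(lra) ltac:(lra)).
    assert (A : 0 <= x t1 / - Z < 1).
    { replace (x t1 / - Z) with (- x t1 / Z) by (field; lra).
      split; [apply Rdiv_le_0_compat; lra|].
      apply Rmult_lt_reg_r with Z; auto; unfold Rdiv; rewrite Rmult_assoc, Rinv_l; lra. }
    destruct (HH _ A) as [HF1 _]; rewrite <- Y, Hy1 in HF1; nra.
Qed.

(** * Convergence of the half return map *)

Lemma half_upto_trunc n k : half_upto n k = PS_trunc n half_coef k.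
Proof.
  destruct (Nat.le_gt_cases k n) as [L|L].
  - rewrite PS_trunc_le by auto.
    induction L as [|n L IH]; [reflexivity|].
    rewrite <- IH; simpl; destruct (Nat.eqb_spec k (S n)); [lia|reflexivity].
  - rewrite PS_trunc_gt by auto.
    induction n as [|n IH]; simpl; [unfold PS_unit; destruct k; [lia|reflexivity]|].
    destruct (Nat.eqb_spec k (S n)); [lia|apply IH; lia].
Qed.

Lemma half_coef_0 : half_coef 0 = 1.
Proof. reflexivity. Qed.

(** The terms [j >= 1] of the recursion, which see the coefficients up to [n] only and
    may therefore use [half_coef] instead of its truncation *)
Definition half_rest (n : nat) : R :=
  sum_f_R0 (fun i => crossing_coef (S i) * (- kappa) ^ S i
                     * PS_pow half_coef (3 * i + 7) (n - i)) n.

Lemma half_coef_succ n :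
  4 * half_coef (S n)
  = crossing_coef (S n) * kappa ^ S n - PS_pow (half_upto n) 4 (S n) - half_rest n.
Proof.
  unfold half_coef; cbn [half_upto]; rewrite Nat.eqb_refl; fold kappa.
  rewrite decomp_sum by lia; cbn [Nat.pred].
  replace (crossing_coef 0 * (- kappa) ^ 0 * PS_pow (half_upto n) (3 * 0 + 4) (S n - 0))
    with (PS_pow (half_upto n) 4 (S n))
    by (unfold crossing_coef; cbn -[PS_pow half_upto]; ring).
  rewrite (sum_eq _ (fun i => crossing_coef (S i) * (- kappa) ^ S i
                     * PS_pow half_coef (3 * i + 7) (n - i))).
  - unfold half_rest; field.
  - intros i Hi; f_equal.
    replace (3 * S i + 4)%nat with (3 * i + 7)%nat by lia.
    replace (S n - S i)%nat with (n - i)%nat by lia.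
    apply PS_pow_ext; intros k Hk.
    rewrite half_upto_trunc, PS_trunc_le; auto; lia.
Qed.

(** Small enough for [kappa * half_radius * (11/10) ^ 3 <= v_radius / 4] *)
Definition half_radius : R := 1 / 800.

Lemma crossing_succ n : crossing_coef (S n) = qtail 1 (S n).
Proof. reflexivity. Qed.

Lemma crossing_sum z K :
  0 <= z <= v_radius / 4 -> sum_f_R0 (fun i => Rabs (crossing_coef (S i)) * z ^ S i) K <= 1 / 8.
Proof.
  intros Hz.
  assert (B := qtail_bound 1 ltac:(lra) (S K)).
  rewrite wnorm_split, qtail_0, Rabs_R0, Rplus_0_l in B; unfold wnorm in B.
  rewrite scal_sum in B.
  apply Rle_trans with (1 / 4 * (1 / 2)); [|lra].
  eapply Rle_trans; [|apply Rmult_le_compat_l; [lra|exact B]].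
  rewrite scal_sum; apply sum_Rle; intros n _.
  rewrite crossing_succ, !Rmult_assoc; apply Rmult_le_compat_l; [apply Rabs_pos|].
  apply Rle_trans with ((v_radius / 4) ^ S n); [now apply pow_incr|].
  unfold Rdiv; rewrite Rpow_mult_distr; simpl.
  assert (0 <= v_radius ^ n) by (apply pow_le; unfold v_radius; lra).
  assert (0 <= (/ 4) ^ n <= 1).
  { split; [apply pow_le; lra|rewrite <- (pow1 n); apply pow_incr; lra]. }
  assert (0 <= v_radius ^ n * v_radius) by (apply Rmult_le_pos; unfold v_radius in *; lra).
  nra.
Qed.

(** In degree [n + 1] the fourth power of the series truncated at [n] lacks exactly
    the term [4 * half_coef (S n)].  With [B] the truncation of the absolute values at
    [K], what remains is dominated by [B ^ 4 - 1 - 4 * (B - 1)], which is quadratic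
    in [B - 1]. *)
Lemma half_upto_pow4 rho K :
  0 <= rho ->
  rho * wnorm rho K (fun n => PS_pow (half_upto n) 4 (S n))
  <= wnorm rho K half_coef ^ 4 - 1 - 4 * (wnorm rho K half_coef - 1).
Proof.
  intros Hr; set (a := wnorm rho K half_coef).
  set (B := PS_trunc K (fun k => Rabs (half_coef k))).
  assert (B0 : B 0%nat = 1).
  { unfold B; rewrite PS_trunc_le, half_coef_0, Rabs_R1 by lia; reflexivity. }
  assert (BP : forall n, 0 <= B n).
  { intros n; unfold B, PS_trunc; destruct (Nat.leb n K); [apply Rabs_pos|lra]. }
  assert (Ba : wnorm rho (S K) B = a).
  { unfold a, wnorm; rewrite (sum_extend0 _ K (S K)) by
      (try lia; intros; unfold B; rewrite PS_trunc_gt, Rabs_R0 by auto; ring).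
    apply sum_eq; intros; unfold B; rewrite PS_trunc_le, Rabs_Rabsolu; auto. }
  assert (S1 : wnorm rho (S K) (PS_pow B 4) <= a ^ 4) by (rewrite <- Ba; now apply wnorm_pow).
  rewrite wnorm_split in S1, Ba.
  rewrite PS_pow_0, B0, pow1, Rabs_R1 in S1; rewrite B0, Rabs_R1 in Ba.
  assert (T : wnorm rho K (fun n => PS_pow (half_upto n) 4 (S n))
      <= wnorm rho K (fun n => PS_pow B 4 (S n)) - 4 * wnorm rho K (fun n => B (S n))).
  { unfold wnorm; rewrite scal_sum, <- minus_sum; apply sum_Rle; intros n Hn.
    assert (P : 0 <= rho ^ n) by now apply pow_le.
    rewrite (Rabs_pos_eq (B (S n))) by auto.
    assert (E := PS_pow_perturb 4 n B (fun k => Rabs (half_upto n k)) B0).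
    cbv beta in E; rewrite (half_upto_trunc n (S n)), PS_trunc_gt, Rabs_R0 in E by lia.
    assert (A := PS_pow_abs (half_upto n) 4 (S n)).
    rewrite Rminus_0_r in E; simpl INR in E.
    assert (Q := Rle_abs (PS_pow B 4 (S n))).
    assert (F : Rabs (PS_pow (half_upto n) 4 (S n))
                <= Rabs (PS_pow B 4 (S n)) - 4 * B (S n)).
    { enough (X : PS_pow B 4 (S n) - PS_pow (fun k => Rabs (half_upto n k)) 4 (S n)
              = (1 + 1 + 1 + 1) * B (S n)) by lra.
      apply E; intros k Hk; rewrite half_upto_trunc; unfold B; rewrite !PS_trunc_le by lia.
      reflexivity. }
    apply (Rmult_le_compat_r (rho ^ n)) in F; auto; lra. }
  apply (Rmult_le_compat_l rho) in T; auto; lra.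
Qed.

Lemma half_rest_bound K :
  wnorm half_radius K half_coef <= 11 / 10 ->
  half_radius * wnorm half_radius K half_rest <= 2 / 10.
Proof.
  intros Ha; set (a := wnorm half_radius K half_coef) in *.
  assert (Pr : 0 < half_radius) by (unfold half_radius; lra).
  assert (Pa : 0 <= a) by (apply wnorm_nonneg; lra).
  assert (PK := kappa_range).
  rewrite (wnorm_ext _ _ _ (fun n => sum_f_R0 (fun i =>
     (crossing_coef (S i) * (- kappa) ^ S i)
     * PS_shift i (PS_pow half_coef (3 * i + 7)) n) K)).
  2:{ intros n Hn; unfold half_rest; rewrite (sum_extend0 _ n K); auto.
      - apply sum_eq; intros i Hi; unfold PS_shift.
        apply Nat.leb_le in Hi; now rewrite Hi.
      - intros i Hi; unfold PS_shift; apply Nat.leb_gt in Hi; rewrite Hi; ring. }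
  (* [1.331] and [1.4641] are the third and fourth powers of [11/10]. *)
  apply Rle_trans with (1.4641 * sum_f_R0 (fun i =>
     Rabs (crossing_coef (S i)) * (kappa * half_radius * 1.331) ^ S i) K).
  2:{ assert (X := crossing_sum (kappa * half_radius * 1.331) K); unfold half_radius, v_radius in *; nra. }
  eapply Rle_trans; [apply Rmult_le_compat_l; [lra|apply wnorm_sum; lra]|].
  rewrite !scal_sum; apply sum_Rle; intros i Hi.
  rewrite wnorm_scal, Rabs_mult, <- RPow_abs, Rabs_Ropp, (Rabs_pos_eq kappa) by lra.
  rewrite !Rmult_assoc; apply Rmult_le_compat_l; [apply Rabs_pos|].
  assert (W : wnorm half_radius K (PS_shift i (PS_pow half_coef (3 * i + 7)))
    <= half_radius ^ i * (1.4641 * 1.331 ^ S i)).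
  { eapply Rle_trans; [apply wnorm_shift; lra|].
    apply Rmult_le_compat_l; [apply pow_le; lra|].
    eapply Rle_trans; [apply wnorm_pow; lra|]; fold a.
    apply Rle_trans with ((11 / 10) ^ (3 * i + 7)); [apply pow_incr; lra|].
    replace (3 * i + 7)%nat with (4 + 3 * S i)%nat by lia.
    rewrite pow_add, pow_mult.
    replace ((11 / 10) ^ 3) with 1.331 by lra.
    replace ((11 / 10) ^ 4) with 1.4641 by lra; lra. }
  assert (Pk : 0 <= kappa ^ S i) by (apply pow_le; lra).
  apply Rle_trans with (kappa ^ S i * (half_radius ^ i * (1.4641 * 1.331 ^ S i) * half_radius)).
  - apply Rmult_le_compat_l; auto; apply Rmult_le_compat_r; lra.
  - rewrite !Rpow_mult_distr; simpl; lra.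
Qed.

(** Write [1 + b] for the norm at order [K], with [b <= 1/10].  Four times its excess over
    [1] at order [K + 1] is at most [1/8] from the right-hand side of the recursion,
    [2/10] from the terms with [j >= 1], and [6 * b ^ 2 + 4 * b ^ 3 + b ^ 4 <= 65/1000]
    from the fourth power, in total less than [4/10]. *)
Lemma half_coef_wnorm K : wnorm half_radius K half_coef <= 11 / 10.
Proof.
  assert (Pr : 0 < half_radius) by (unfold half_radius; lra).
  assert (PK := kappa_range).
  induction K as [|K IH].
  - unfold wnorm; simpl; rewrite half_coef_0, Rabs_R1; lra.
  - rewrite wnorm_split, half_coef_0, Rabs_R1.
    enough (half_radius * wnorm half_radius K (fun n => 4 * half_coef (S n)) <= 4 / 10) as B.
    { rewrite (wnorm_scal _ _ 4 (fun n => half_coef (S n))), Rabs_pos_eq in B; lra. }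
    rewrite (wnorm_ext _ _ _ (fun n => crossing_coef (S n) * kappa ^ S n
       - PS_pow (half_upto n) 4 (S n) - half_rest n)) by (intros; apply half_coef_succ).
    assert (B1 := wnorm_minus half_radius K (fun n => crossing_coef (S n) * kappa ^ S n
       - PS_pow (half_upto n) 4 (S n)) half_rest ltac:(lra)).
    assert (B2 := wnorm_minus half_radius K (fun n => crossing_coef (S n) * kappa ^ S n)
       (fun n => PS_pow (half_upto n) 4 (S n)) ltac:(lra)).
    assert (B3 := half_rest_bound K IH).
    assert (B4 := half_upto_pow4 half_radius K ltac:(lra)).
    assert (B5 : half_radius * wnorm half_radius K (fun n => crossing_coef (S n) * kappa ^ S n) <= 1 / 8).
    { eapply Rle_trans; [|apply (crossing_sum (kappa * half_radius) K); unfold v_radius, half_radius; lra].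
      unfold wnorm; rewrite scal_sum; right; apply sum_eq; intros n _.
      rewrite Rabs_mult, (Rabs_pos_eq (kappa ^ S n)) by (apply pow_le; lra).
      rewrite Rpow_mult_distr; simpl; ring. }
    set (a := wnorm half_radius K half_coef) in *.
    assert (A1 : 1 <= a).
    { apply Rle_trans with (wnorm half_radius 0 half_coef).
      - unfold wnorm; simpl; rewrite half_coef_0, Rabs_R1; lra.
      - apply wnorm_mono; [lra|lia]. }
    assert (A2 : a ^ 4 - 1 - 4 * (a - 1) <= 65 / 1000).
    { set (b := a - 1); replace a with (1 + b) by (unfold b; ring).
      assert (Hb : 0 <= b <= 1 / 10) by (unfold b; lra).
      replace ((1 + b) ^ 4 - 1 - 4 * b) with (b ^ 2 * (6 + 4 * b + b ^ 2)) by ring.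
      assert (0 <= b ^ 2 <= 1 / 100) by nra.
      nra. }
    apply (Rmult_le_compat_l half_radius) in B1; [|lra].
    apply (Rmult_le_compat_l half_radius) in B2; [|lra].
    lra.
Qed.

Lemma half_coef_bound : wbound half_radius (11 / 10) half_coef.
Proof. exact half_coef_wnorm. Qed.

(** The estimate of [half_coef_wnorm] without its constant term, on half the radius *)
Lemma half_value s : Rabs s <= half_radius / 2 -> Rabs (PSeries half_coef s - 1) <= 1 / 20.
Proof.
  intros Hs.
  assert (Pr : 0 < half_radius) by (unfold half_radius; lra).
  rewrite PSeries_decr_1.
  - rewrite half_coef_0.
    replace (1 + s * PSeries (PS_decr_1 half_coef) s - 1)
      with (s * PSeries (PS_decr_1 half_coef) s) by ring.
    rewrite Rabs_mult.
    assert (B : Rabs (PSeries (PS_decr_1 half_coef) s) <= 1 / 10 / half_radius).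
    { apply (wbound_PSeries_abs half_radius); [lra|]; intros K.
      assert (X := half_coef_wnorm (S K)); rewrite wnorm_split, half_coef_0, Rabs_R1 in X.
      change (PS_decr_1 half_coef) with (fun n => half_coef (S n)).
      apply Rmult_le_reg_l with half_radius; auto.
      replace (half_radius * (1 / 10 / half_radius)) with (1 / 10) by (field; lra); lra. }
    apply Rle_trans with (half_radius / 2 * (1 / 10 / half_radius)).
    + apply Rmult_le_compat; auto; apply Rabs_pos.
    + right; field; lra.
  - exists (PSeries half_coef s); apply (wbound_is_pseries half_radius (11 / 10));
      [lra|apply half_coef_bound].
Qed.

(** * The half return map *)

Lemma crossing_term j : Rabs (crossing_coef j) * v_radius ^ j <= 1.
Proof.
  destruct j as [|j]; [unfold crossing_coef; simpl; rewrite Rabs_R1; lra|].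
  rewrite crossing_succ.
  assert (B := qtail_bound 1 ltac:(lra) (S j)).
  eapply Rle_trans; [apply (wnorm_term v_radius (S j)); [unfold v_radius; lra|lia]|lra].
Qed.

(** The recursion with the unknown coefficient moved back to the left-hand side: this is
    the coefficientwise form of [A ^ 4 * Q (- kappa * s * A ^ 3) = Q (kappa * s)]. *)
Lemma half_coef_spec n :
  sum_f_R0 (fun j => crossing_coef j * (- kappa) ^ j
                     * PS_pow half_coef (3 * j + 4) (n - j)) n
  = crossing_coef n * kappa ^ n.
Proof.
  destruct n as [|n].
  + simpl; unfold PS_mult, PS_unit, crossing_coef; simpl; rewrite half_coef_0; ring.
  + rewrite decomp_sum by lia; cbn [Nat.pred].
    replace (3 * 0 + 4)%nat with 4%nat by lia; rewrite Nat.sub_0_r.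
    assert (E := PS_pow_perturb 4 n half_coef (half_upto n) half_coef_0).
    rewrite (half_upto_trunc n (S n)), PS_trunc_gt in E by lia.
    assert (R := half_coef_succ n).
    rewrite (sum_eq _ (fun i => crossing_coef (S i) * (- kappa) ^ S i
                   * PS_pow half_coef (3 * i + 7) (n - i))).
    * fold (half_rest n).
      rewrite Rminus_0_r in E; simpl INR in E.
      replace (crossing_coef 0 * (- kappa) ^ 0) with 1 by (unfold crossing_coef; simpl; ring).
      enough (X : PS_pow half_coef 4 (S n) - PS_pow (half_upto n) 4 (S n)
        = (1 + 1 + 1 + 1) * half_coef (S n)) by lra.
      apply E; intros k Hk; rewrite half_upto_trunc, PS_trunc_le; auto.
    * intros i Hi; replace (3 * S i + 4)%nat with (3 * i + 7)%nat by lia; reflexivity.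
Qed.

Lemma half_equation s :
  Rabs s <= half_radius / 2 ->
  PSeries half_coef s ^ 4 * PSeries crossing_coef (kappa * (- (s * PSeries half_coef s ^ 3)))
  = PSeries crossing_coef (kappa * s).
Proof.
  intros Hs; assert (PK := kappa_range).
  assert (H := is_pseries_subst (fun j => crossing_coef j * (- kappa) ^ j) half_coef 4
    half_radius 1 (11 / 10) (1 / 4) s).
  set (A := PSeries half_coef s) in *.
  assert (E1 : PSeries crossing_coef (kappa * - (s * A ^ 3))
    = PSeries (fun j => crossing_coef j * (- kappa) ^ j) (s * A ^ 3)).
  { apply Series_ext; intros j.
    replace (kappa * - (s * A ^ 3)) with (- kappa * (s * A ^ 3)) by ring.
    rewrite Rpow_mult_distr; ring. }
  rewrite E1.
  assert (E2 : PSeries crossing_coef (kappa * s)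
    = PSeries (fun j => crossing_coef j * kappa ^ j) s).
  { apply Series_ext; intros j; rewrite Rpow_mult_distr; ring. }
  rewrite E2; symmetry; apply is_pseries_unique.
  eapply is_pseries_ext; [|apply H]; clear H; auto; try (unfold half_radius in *; lra).
  - intros n; apply half_coef_spec.
  - apply half_coef_bound.
  - intros j; rewrite Rabs_mult, <- RPow_abs, Rabs_Ropp, (Rabs_pos_eq kappa) by lra.
    rewrite !Rmult_assoc, <- !Rpow_mult_distr, Rmult_1_l.
    apply Rle_trans with (Rabs (crossing_coef j) * (v_radius * (1 / 4)) ^ j).
    + apply Rmult_le_compat_l; [apply Rabs_pos|].
      apply pow_incr; unfold half_radius, v_radius; split; [|lra].
      apply Rmult_le_pos; lra.
    + rewrite Rpow_mult_distr, <- Rmult_assoc.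
      assert (X := crossing_term j).
      apply (Rmult_le_compat_r ((1 / 4) ^ j)) in X; [lra|apply pow_le; lra].
Qed.

(** The bound on [Z ^ 3] leaves room for applying the half return map a second time. *)
Lemma half_return eps x y :
  0 < eps -> eps ^ 3 <= half_radius / 2 -> is_solution eps x y ->
  let Z := eps * PSeries half_coef (eps ^ 3) in
  0 < Z /\ Z ^ 3 <= 2 * eps ^ 3 /\
  exists t1, 0 < t1 /\ y t1 = 0 /\ x t1 = - Z /\ forall t, 0 < t < t1 -> 0 < y t.
Proof.
  intros He Hs Hsol Z.
  assert (Ps : 0 < eps ^ 3) by now apply pow_lt.
  assert (Hs' : Rabs (eps ^ 3) <= half_radius / 2) by (rewrite Rabs_pos_eq; lra).
  assert (PK := kappa_range).
  assert (HA := half_value _ Hs').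
  assert (HE := half_equation _ Hs').
  set (A := PSeries half_coef (eps ^ 3)) in *.
  apply Rabs_le_between in HA.
  assert (HA3 : 0 < A ^ 3 <= 2).
  { split; [apply pow_lt; lra|].
    apply Rle_trans with ((21 / 20) ^ 3); [apply pow_incr; lra|lra]. }
  assert (PZ : 0 < Z) by (apply Rmult_lt_0_compat; lra).
  assert (EZ : Z ^ 3 = eps ^ 3 * A ^ 3) by (unfold Z; ring).
  assert (ZB : 0 < Z ^ 3 <= 2 * eps ^ 3) by (rewrite EZ; split; nra).
  split; [auto|split; [lra|]].
  apply (half_turn eps Z x y); auto.
  - rewrite Rabs_mult, !Rabs_pos_eq by lra; unfold half_radius, v_radius in *; nra.
  - replace ((- Z) ^ 3) with (- Z ^ 3) by ring.
    rewrite Rabs_mult, Rabs_Ropp, !Rabs_pos_eq by lra; unfold half_radius, v_radius in *; nra.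
  - replace ((- Z) ^ 3) with (- (eps ^ 3 * A ^ 3)) by (rewrite <- EZ; ring).
    rewrite <- HE; unfold Z; ring.
Qed.

(** * Existence of solutions *)

Definition sat (x : R) : R := (Rabs (x + 1) - Rabs (x - 1)) / 2.

(** Agrees with the cube on [[-1, 1]], and is globally Lipschitz, bounded and monotone *)
Definition sat_cube (x : R) : R := sat x ^ 3.

Lemma sat_range x : -1 <= sat x <= 1.
Proof. unfold sat, Rabs; destruct (Rcase_abs (x + 1)), (Rcase_abs (x - 1)); lra. Qed.

Lemma sat_id x : -1 <= x <= 1 -> sat x = x.
Proof. unfold sat, Rabs; destruct (Rcase_abs (x + 1)), (Rcase_abs (x - 1)); lra. Qed.

Lemma sat_mono x y : x <= y -> sat x <= sat y.
Proof.
  unfold sat, Rabs; destruct (Rcase_abs (x + 1)), (Rcase_abs (x - 1)),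
    (Rcase_abs (y + 1)), (Rcase_abs (y - 1)); lra.
Qed.

Lemma sat_lip x y : Rabs (sat x - sat y) <= Rabs (x - y).
Proof.
  unfold sat, Rabs; destruct (Rcase_abs (x + 1)), (Rcase_abs (x - 1)),
    (Rcase_abs (y + 1)), (Rcase_abs (y - 1)), (Rcase_abs (x - y));
  match goal with |- context [Rcase_abs ?z] => destruct (Rcase_abs z) end; lra.
Qed.

Lemma sat_cube_range x : -1 <= sat_cube x <= 1.
Proof.
  unfold sat_cube; assert (H := sat_range x).
  assert (0 <= sat x ^ 2 <= 1) by nra.
  replace (sat x ^ 3) with (sat x * sat x ^ 2) by ring; nra.
Qed.

Lemma sat_cube_lip x y : Rabs (sat_cube x - sat_cube y) <= 3 * Rabs (x - y).
Proof.
  unfold sat_cube.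
  replace (sat x ^ 3 - sat y ^ 3)
    with ((sat x ^ 2 + sat x * sat y + sat y ^ 2) * (sat x - sat y)) by ring.
  rewrite Rabs_mult.
  assert (H1 := sat_range x); assert (H2 := sat_range y).
  apply Rmult_le_compat; try apply Rabs_pos; [|apply sat_lip].
  assert (0 <= sat x ^ 2 <= 1) by nra.
  assert (0 <= sat y ^ 2 <= 1) by nra.
  assert (-1 <= sat x * sat y <= 1) by nra.
  apply Rabs_le; lra.
Qed.

Lemma sat_cube_mono x y : x <= y -> sat_cube x <= sat_cube y.
Proof.
  intros H; unfold sat_cube; assert (S := sat_mono x y H).
  enough (0 <= sat y ^ 3 - sat x ^ 3) by lra.
  replace (sat y ^ 3 - sat x ^ 3)
    with ((sat y - sat x) * ((sat x + sat y / 2) ^ 2 + 3 / 4 * sat y ^ 2)) by field.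
  apply Rmult_le_pos; [lra|].
  generalize (pow2_ge_0 (sat x + sat y / 2)) (pow2_ge_0 (sat y)); lra.
Qed.

Lemma sat_cube_id x : -1 <= x <= 1 -> sat_cube x = x ^ 3.
Proof. intros; unfold sat_cube; now rewrite sat_id. Qed.

Lemma cont_sat_cube : cont sat_cube.
Proof.
  unfold sat_cube; apply (cont_pow sat); unfold sat, Rdiv; apply cont_mult, cont_const.
  apply cont_minus; apply cont_abs;
    [apply cont_plus|apply cont_minus]; apply cont_id || apply cont_const.
Qed.

Definition pos_part (t : R) : R := (t + Rabs t) / 2.

Lemma pos_part_nonneg t : 0 <= pos_part t.
Proof. unfold pos_part, Rabs; destruct (Rcase_abs t); lra. Qed.

Lemma pos_part_id t : 0 <= t -> pos_part t = t.
Proof. unfold pos_part, Rabs; destruct (Rcase_abs t); lra. Qed.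

Lemma pos_part_le t s : Rabs (s - t) < 1 -> pos_part s <= pos_part t + 1.
Proof.
  unfold pos_part, Rabs; destruct (Rcase_abs t), (Rcase_abs s), (Rcase_abs (s - t)); lra.
Qed.

Lemma cont_pos_part : cont pos_part.
Proof.
  unfold pos_part, Rdiv; apply cont_mult, cont_const.
  apply cont_plus; [apply cont_id|apply cont_abs, cont_id].
Qed.

(** Constant on negative times, so that estimates are needed for [t >= 0] only *)
Definition frozen_primitive (f : R -> R) (t : R) : R := RInt f 0 (pos_part t).

Lemma is_derive_RInt0 f t : cont f -> is_derive (fun t => RInt f 0 t) t (f t).
Proof.
  intros Hf; apply (is_derive_RInt f (fun t => RInt f 0 t) 0 t); auto.
  exists (mkposreal 1 Rlt_0_1); intros z _; apply (RInt_correct f), cont_ex_RInt, Hf.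
Qed.

Lemma cont_frozen_primitive f : cont f -> cont (frozen_primitive f).
Proof.
  intros Hf; apply (cont_comp pos_part (fun t => RInt f 0 t)); [apply cont_pos_part|].
  intros t; apply (ex_derive_continuous (fun t => RInt f 0 t)).
  eexists; now apply is_derive_RInt0.
Qed.

(** The weight [exp (12 * t)] turns integration into a contraction by [1/2], because the
    truncated field has Lipschitz constant [6]; no restriction to short times arises. *)
Lemma frozen_primitive_diff f g t M :
  cont f -> cont g -> 0 < M ->
  (forall s, 0 <= s -> Rabs (f s - g s) <= 6 * M * exp (12 * s)) ->
  Rabs (frozen_primitive f t - frozen_primitive g t) <= M / 2 * exp (12 * pos_part t).
Proof.
  intros Hf Hg HM H; unfold frozen_primitive; set (b := pos_part t).
  assert (Hb : 0 <= b) by apply pos_part_nonneg.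
  assert (Cd : cont (fun s => f s - g s)) by now apply cont_minus.
  assert (E : RInt f 0 b - RInt g 0 b = RInt (fun s => f s - g s) 0 b).
  { symmetry; apply (is_RInt_unique (V := R_CompleteNormedModule)).
    apply (is_RInt_minus (V := R_NormedModule)).
    - apply (RInt_correct f), cont_ex_RInt, Hf.
    - apply (RInt_correct g), cont_ex_RInt, Hg. }
  rewrite E; clear E.
  (* [12] is twice the Lipschitz constant: the primitive of [6 * M * exp (12 * s)] is
     [M / 2 * exp (12 * s)]. *)
  assert (I : is_RInt (fun s => 6 * M * exp (12 * s)) 0 b
     (minus (M / 2 * exp (12 * b)) (M / 2 * exp (12 * 0)))).
  { apply (is_RInt_derive (fun s => M / 2 * exp (12 * s))).
    - intros s _; auto_derive; auto; field.
    - intros s _; apply (ex_derive_continuous (fun s => 6 * M * exp (12 * s))).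
      auto_derive; auto. }
  eapply Rle_trans; [apply abs_RInt_le; auto; now apply cont_ex_RInt|].
  eapply Rle_trans.
  - apply (RInt_le _ (fun s => 6 * M * exp (12 * s)) 0 b Hb).
    + apply cont_ex_RInt, cont_abs, Cd.
    + eexists; apply I.
    + intros s Hs; apply H; lra.
  - rewrite (is_RInt_unique _ _ _ _ I); unfold minus, plus, opp; simpl.
    rewrite Rmult_0_r, exp_0; lra.
Qed.

Fixpoint picard (eps : R) (n : nat) : (R -> R) * (R -> R) :=
  match n with
  | O => (fun _ => eps, fun _ => 0)
  | S n => let u := picard eps n in
      (fun t => eps - frozen_primitive (snd u) t, frozen_primitive (fun s => sat_cube (fst u s) - sat_cube (snd u s)))
  end.

Lemma cont_field x y : cont x -> cont y -> cont (fun s => sat_cube (x s) - sat_cube (y s)).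
Proof.
  intros Hx Hy; apply cont_minus; apply (cont_comp _ sat_cube); auto using cont_sat_cube.
Qed.

Lemma picard_cont eps n : cont (fst (picard eps n)) /\ cont (snd (picard eps n)).
Proof.
  induction n as [|n [IH1 IH2]]; simpl; [split; apply cont_const|].
  split.
  - apply cont_minus; [apply cont_const|now apply cont_frozen_primitive].
  - now apply cont_frozen_primitive, cont_field.
Qed.

Lemma field_diff (a b a' b' M : R) :
  Rabs (a - a') <= M -> Rabs (b - b') <= M ->
  Rabs (sat_cube a - sat_cube b - (sat_cube a' - sat_cube b')) <= 6 * M.
Proof.
  intros Ha Hb.
  replace (sat_cube a - sat_cube b - (sat_cube a' - sat_cube b'))
    with (sat_cube a - sat_cube a' + - (sat_cube b - sat_cube b')) by ring.
  eapply Rle_trans; [apply Rabs_triang|]; rewrite Rabs_Ropp.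
  assert (A := sat_cube_lip a a'); assert (B := sat_cube_lip b b'); lra.
Qed.

Lemma picard_step eps n t :
  Rabs (fst (picard eps (S n)) t - fst (picard eps n) t)
    <= (/ 2) ^ n * exp (12 * pos_part t) /\
  Rabs (snd (picard eps (S n)) t - snd (picard eps n) t)
    <= (/ 2) ^ n * exp (12 * pos_part t).
Proof.
  revert t; induction n as [|n IH]; intros t.
  - simpl; assert (P := pos_part_nonneg t).
    assert (X := exp_ineq1_le (12 * pos_part t)).
    assert (Z : frozen_primitive (fun _ => 0) t = 0).
    { unfold frozen_primitive; rewrite RInt_const; unfold scal; simpl; unfold mult; simpl; ring. }
    split.
    + rewrite Z; replace (eps - 0 - eps) with 0 by ring; rewrite Rabs_R0.
      lra.
    + rewrite Rminus_0_r; unfold frozen_primitive.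
      eapply Rle_trans; [apply (RInt_abs_const _ 0 (pos_part t) 2); auto|lra].
      * apply (cont_field (fun _ => eps) (fun _ => 0)); apply cont_const.
      * intros s _; assert (A := sat_cube_range eps); assert (B := sat_cube_range 0).
        apply Rabs_le; lra.
  - assert (C1 := picard_cont eps n); assert (C2 := picard_cont eps (S n)).
    assert (P2 : 0 < (/ 2) ^ n) by (apply pow_lt; lra).
    change (fst (picard eps (S (S n)))) with (fun t => eps - frozen_primitive (snd (picard eps (S n))) t).
    change (snd (picard eps (S (S n)))) with
      (frozen_primitive (fun s => sat_cube (fst (picard eps (S n)) s) - sat_cube (snd (picard eps (S n)) s))).
    change (fst (picard eps (S n)) t) with (eps - frozen_primitive (snd (picard eps n)) t).
    change (snd (picard eps (S n)) t) with
      (frozen_primitive (fun s => sat_cube (fst (picard eps n) s) - sat_cube (snd (picard eps n) s)) t).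
    cbv beta; set (x := fst (picard eps n)) in *; set (y := snd (picard eps n)) in *.
    set (x' := fst (picard eps (S n))) in *; set (y' := snd (picard eps (S n))) in *.
    replace ((/ 2) ^ S n) with ((/ 2) ^ n / 2) by (simpl; lra).
    split.
    + replace (eps - frozen_primitive y' t - (eps - frozen_primitive y t)) with (- (frozen_primitive y' t - frozen_primitive y t)) by ring.
      rewrite Rabs_Ropp; apply frozen_primitive_diff; try tauto.
      intros s Hs; eapply Rle_trans; [apply IH|].
      rewrite pos_part_id by auto.
      assert (0 < exp (12 * s)) by apply exp_pos; nra.
    + apply frozen_primitive_diff; try tauto; try (apply cont_field; tauto).
      intros s Hs; rewrite Rmult_assoc.
      destruct (IH s) as [I1 I2]; rewrite pos_part_id in I1, I2 by auto.
      now apply field_diff.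
Qed.

Lemma geometric_limit (u : nat -> R) C n :
  0 <= C -> (forall n, Rabs (u (S n) - u n) <= C * (/ 2) ^ n) ->
  Rabs (real (Lim_seq u) - u n) <= 2 * C * (/ 2) ^ n.
Proof.
  intros HC H.
  assert (B : forall n k, Rabs (u (n + k)%nat - u n) <= 2 * C * (/ 2) ^ n - 2 * C * (/ 2) ^ (n + k)).
  { intros m k; induction k as [|k IH].
    - rewrite Nat.add_0_r, !Rminus_diag, Rabs_R0; lra.
    - rewrite Nat.add_succ_r.
      replace (u (S (m + k)) - u m) with ((u (S (m + k)) - u (m + k)%nat) + (u (m + k)%nat - u m))
        by ring.
      eapply Rle_trans; [apply Rabs_triang|].
      specialize (H (m + k)%nat); simpl; lra. }
  assert (Pn : forall m, 0 <= 2 * C * (/ 2) ^ m)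
    by (intros; apply Rmult_le_pos; [lra|apply pow_le; lra]).
  assert (L : ex_finite_lim_seq u).
  { apply ex_lim_seq_cauchy_corr; intros e.
    destruct (proj1 (is_lim_seq_Reals _ _) (is_lim_seq_geom_half (2 * C)) (e / 2)) as [N HN].
    - destruct e; simpl; lra.
    - exists N.
      assert (Q : 2 * C * (/ 2) ^ N < e / 2).
      { specialize (HN N (Nat.le_refl _)); unfold Rdist in HN; rewrite Rminus_0_r in HN.
        eapply Rle_lt_trans; [apply Rle_abs|exact HN]. }
      intros i j Hi Hj.
      assert (Bi := B N (i - N)%nat); assert (Bj := B N (j - N)%nat).
      replace (N + (i - N))%nat with i in Bi by lia.
      replace (N + (j - N))%nat with j in Bj by lia.
      assert (Pi := Pn i); assert (Pj := Pn j).
      replace (u i - u j) with ((u i - u N) + - (u j - u N)) by ring.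
      eapply Rle_lt_trans; [apply Rabs_triang|]; rewrite Rabs_Ropp; lra. }
  apply Lim_seq_correct' in L.
  apply (is_lim_seq_incr_n _ n) in L.
  assert (L2 := is_lim_seq_abs _ _ (is_lim_seq_minus' _ _ _ _ L (is_lim_seq_const (u n)))).
  refine (is_lim_seq_le _ _ _ _ _ L2 (is_lim_seq_const _)).
  intros k; simpl; rewrite Nat.add_comm; eapply Rle_trans; [apply B|].
  specialize (Pn (n + k)%nat); lra.
Qed.

(** The limits of the iterates solve the integral equation for nonnegative times but are
    constant for negative ones.  Integrating the field along them over signed intervals
    gives functions that are also differentiable at [0]. *)
Lemma saturated_solution eps :
  exists x y : R -> R, x 0 = eps /\ y 0 = 0 /\
    forall t, 0 <= t -> is_derive x t (- y t) /\ is_derive y t (sat_cube (x t) - sat_cube (y t)).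
Proof.
  set (xl := fun t => real (Lim_seq (fun n => fst (picard eps n) t))).
  set (yl := fun t => real (Lim_seq (fun n => snd (picard eps n) t))).
  assert (Ax : forall n t, Rabs (xl t - fst (picard eps n) t)
                 <= 2 * exp (12 * pos_part t) * (/ 2) ^ n).
  { intros n t; apply (geometric_limit (fun n => fst (picard eps n) t)).
    - left; apply exp_pos.
    - intros k; rewrite Rmult_comm; apply picard_step. }
  assert (Ay : forall n t, Rabs (yl t - snd (picard eps n) t)
                 <= 2 * exp (12 * pos_part t) * (/ 2) ^ n).
  { intros n t; apply (geometric_limit (fun n => snd (picard eps n) t)).
    - left; apply exp_pos.
    - intros k; rewrite Rmult_comm; apply picard_step. }
  assert (Loc : forall t s, Rabs (s - t) < 1 ->
             exp (12 * pos_part s) <= exp (12 * (pos_part t + 1))).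
  { intros t s Hts; apply pos_part_le in Hts.
    destruct (Rle_lt_or_eq_dec _ _ Hts) as [L|E]; [left; apply exp_increasing; lra|].
    rewrite E; lra. }
  assert (Cx : cont xl).
  { apply (cont_uniform_limit (fun n => fst (picard eps n)) _ (fun t => 2 * exp (12 * (pos_part t + 1)))).
    - intros n; apply picard_cont.
    - intros N t s Hts; eapply Rle_trans; [apply Ax|].
      apply Rmult_le_compat_r; [apply pow_le; lra|].
      specialize (Loc t s Hts); lra. }
  assert (Cy : cont yl).
  { apply (cont_uniform_limit (fun n => snd (picard eps n)) _ (fun t => 2 * exp (12 * (pos_part t + 1)))).
    - intros n; apply picard_cont.
    - intros N t s Hts; eapply Rle_trans; [apply Ay|].
      apply Rmult_le_compat_r; [apply pow_le; lra|].
      specialize (Loc t s Hts); lra. }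
  assert (Fx : forall t, xl t = eps - frozen_primitive yl t).
  { intros t; apply Rminus_diag_uniq, (eq_0_of_geometric_bound _ (2 * exp (12 * pos_part t))); intros n.
    assert (A := Ax (S n) t); change ((/ 2) ^ S n) with (/ 2 * (/ 2) ^ n) in A.
    assert (B := frozen_primitive_diff yl (snd (picard eps n)) t (2 * (/ 2) ^ n) Cy
                   (proj2 (picard_cont eps n))).
    change (fst (picard eps (S n)) t) with (eps - frozen_primitive (snd (picard eps n)) t) in A.
    assert (B' : Rabs (frozen_primitive yl t - frozen_primitive (snd (picard eps n)) t)
                 <= 2 * (/ 2) ^ n / 2 * exp (12 * pos_part t)).
    { apply B; [assert (0 < (/ 2) ^ n) by (apply pow_lt; lra); lra|].
      intros s Hs; eapply Rle_trans; [apply Ay|]; rewrite pos_part_id by auto.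
      assert (0 < exp (12 * s) * (/ 2) ^ n)
        by (apply Rmult_lt_0_compat; [apply exp_pos|apply pow_lt; lra]); lra. }
    set (y := snd (picard eps n)) in *.
    replace (xl t - (eps - frozen_primitive yl t))
      with ((xl t - (eps - frozen_primitive y t)) + (frozen_primitive yl t - frozen_primitive y t)) by ring.
    eapply Rle_trans; [apply Rabs_triang|]; lra. }
  assert (Fy : forall t, yl t = frozen_primitive (fun s => sat_cube (xl s) - sat_cube (yl s)) t).
  { intros t; apply Rminus_diag_uniq, (eq_0_of_geometric_bound _ (2 * exp (12 * pos_part t))); intros n.
    assert (A := Ay (S n) t); change ((/ 2) ^ S n) with (/ 2 * (/ 2) ^ n) in A.
    change (snd (picard eps (S n)) t) with
      (frozen_primitive (fun s => sat_cube (fst (picard eps n) s) - sat_cube (snd (picard eps n) s)) t) in A.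
    destruct (picard_cont eps n) as [C1 C2].
    assert (B' : Rabs (frozen_primitive (fun s => sat_cube (xl s) - sat_cube (yl s)) t
                  - frozen_primitive (fun s => sat_cube (fst (picard eps n) s) - sat_cube (snd (picard eps n) s)) t)
                 <= 2 * (/ 2) ^ n / 2 * exp (12 * pos_part t)).
    { apply frozen_primitive_diff; try (now apply cont_field).
      - assert (0 < (/ 2) ^ n) by (apply pow_lt; lra); lra.
      - intros s Hs; rewrite Rmult_assoc.
        assert (A1 := Ax n s); assert (A2 := Ay n s).
        rewrite pos_part_id in A1, A2 by auto.
        apply field_diff; lra. }
    set (P := frozen_primitive (fun s => sat_cube (fst (picard eps n) s) - sat_cube (snd (picard eps n) s)) t) in *.
    set (Q := frozen_primitive (fun s => sat_cube (xl s) - sat_cube (yl s)) t) in *.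
    replace (yl t - Q) with ((yl t - P) + - (Q - P)) by ring.
    eapply Rle_trans; [apply Rabs_triang|]; rewrite Rabs_Ropp; lra. }
  assert (Cf := cont_field _ _ Cx Cy).
  exists (fun t => eps - RInt yl 0 t), (fun t => RInt (fun s => sat_cube (xl s) - sat_cube (yl s)) 0 t).
  split; [|split].
  - rewrite RInt_point; change zero with 0; ring.
  - now rewrite RInt_point.
  - intros t Ht.
    assert (E1 : xl t = eps - RInt yl 0 t) by (rewrite Fx; unfold frozen_primitive; now rewrite pos_part_id).
    assert (E2 : yl t = RInt (fun s => sat_cube (xl s) - sat_cube (yl s)) 0 t)
      by (rewrite Fy at 1; unfold frozen_primitive; now rewrite pos_part_id).
    rewrite <- E1, <- E2; split.
    + refine (is_derive_eq _ _ _ _ (is_derive_minus _ _ _ _ _ (is_derive_const eps t)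
                (is_derive_RInt0 yl t Cy)) _).
      unfold minus, plus, opp, zero; simpl; ring.
    + exact (is_derive_RInt0 _ t Cf).
Qed.

(** Potential energy of the truncated force; [x ^ 4 / 4] on [[-1, 1]] *)
Definition potential (x : R) : R := RInt sat_cube 0 x.

Lemma potential_mvt a b :
  a < b -> exists c, potential b - potential a = sat_cube c * (b - a) /\ a < c < b.
Proof.
  intros H; apply (MVT_cor2 potential sat_cube a b H); intros c _.
  apply is_derive_Reals, (is_derive_RInt0 sat_cube c cont_sat_cube).
Qed.

Lemma potential_0 : potential 0 = 0.
Proof. unfold potential; now rewrite RInt_point. Qed.

Lemma sat_cube_0 : sat_cube 0 = 0.
Proof. rewrite sat_cube_id; lra. Qed.

Lemma potential_nonneg x : 0 <= potential x.
Proof.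
  destruct (Rtotal_order x 0) as [L|[->|G]].
  - destruct (potential_mvt x 0 L) as [c [E Hc]]; rewrite potential_0 in E.
    assert (P := sat_cube_mono c 0 ltac:(lra)); rewrite sat_cube_0 in P; nra.
  - rewrite potential_0; lra.
  - destruct (potential_mvt 0 x G) as [c [E Hc]]; rewrite potential_0 in E.
    assert (P := sat_cube_mono 0 c ltac:(lra)); rewrite sat_cube_0 in P; nra.
Qed.

Lemma potential_large x : 1 < Rabs x -> 1 / 16 <= potential x.
Proof.
  intros H; unfold Rabs in H; destruct (Rcase_abs x).
  - destruct (potential_mvt x (- / 2)) as [c [E Hc]]; [lra|].
    assert (P := sat_cube_mono c (- / 2) ltac:(lra)); rewrite (sat_cube_id (- / 2)) in P by lra.
    assert (N := potential_nonneg (- / 2)); nra.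
  - destruct (potential_mvt (/ 2) x) as [c [E Hc]]; [lra|].
    assert (P := sat_cube_mono (/ 2) c ltac:(lra)); rewrite (sat_cube_id (/ 2)) in P by lra.
    assert (N := potential_nonneg (/ 2)); nra.
Qed.

(** The energy starts below [1/20], while [potential] is at least [1/16] beyond [[-1, 1]];
    so the truncation is never active. *)
Lemma solution_exists eps : 0 < eps < 1 / 20 -> exists x y, is_solution eps x y.
Proof.
  intros He; destruct (saturated_solution eps) as [x [y [x0 [y0 Hs]]]].
  set (E := fun t => y t ^ 2 / 2 + potential (x t)).
  assert (DE : forall t, 0 <= t -> is_derive E t (- (y t * sat_cube (y t)))).
  { intros t Ht; destruct (Hs t Ht) as [Hx Hy].
    assert (D1 := is_derive_comp potential x t _ _ (is_derive_RInt0 sat_cube (x t) cont_sat_cube) Hx).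
    assert (D2 := is_derive_scal _ _ (/ 2) _ (is_derive_pow y 2 t _ Hy)).
    assert (D3 := is_derive_plus _ _ _ _ _ D2 D1).
    apply (is_derive_ext (fun t => / 2 * y t ^ 2 + potential (x t))).
    { intros s; unfold E; lra. }
    refine (is_derive_eq _ _ _ _ D3 _).
    unfold plus, scal; simpl; unfold mult; simpl; field. }
  assert (BE : forall t, 0 <= t -> E t <= potential eps).
  { intros t [Ht|<-].
    - destruct (MVT_cor2 E (fun t => - (y t * sat_cube (y t))) 0 t Ht) as [c [Hc Hc']].
      + intros c Hc; apply is_derive_Reals, DE; lra.
      + assert (P : 0 <= y c * sat_cube (y c)).
        { destruct (Rle_dec 0 (y c)) as [p|n].
          - assert (P := sat_cube_mono 0 (y c) p); rewrite sat_cube_0 in P; nra.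
          - assert (P := sat_cube_mono (y c) 0 ltac:(lra)); rewrite sat_cube_0 in P; nra. }
        assert (E0 : E 0 = potential eps) by (unfold E; rewrite x0, y0; field).
        nra.
    - unfold E; rewrite x0, y0; lra. }
  assert (Pe : potential eps < 1 / 20).
  { destruct (potential_mvt 0 eps) as [c [Hc _]]; [lra|].
    rewrite potential_0 in Hc; assert (P := sat_cube_range c); nra. }
  assert (B : forall t, 0 <= t -> -1 <= x t <= 1 /\ -1 <= y t <= 1).
  { intros t Ht; assert (A := BE t Ht); unfold E in A; split.
    - destruct (Rle_dec (Rabs (x t)) 1) as [p|n]; [now apply Rabs_le_between|].
      assert (L := potential_large (x t) ltac:(lra)).
      assert (0 <= y t ^ 2) by apply pow2_ge_0; lra.
    - assert (N := potential_nonneg (x t)).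
      assert (y t ^ 2 <= 1) by lra; nra. }
  exists x, y; split; [auto|split; auto].
  intros t Ht; destruct (B t Ht) as [B1 B2].
  destruct (Hs t Ht) as [Hx Hy]; rewrite !sat_cube_id in Hy by auto; auto.
Qed.

(** * The first coefficients *)

Lemma v_1_eq xi : v 1 xi = v1 xi.
Proof.
  rewrite v_succ; unfold avg, v1; f_equal; apply RInt_ext; intros t _; f_equal.
  unfold q32_coef, pow32_coef; simpl; rewrite Rminus_0_r; unfold PS_unit; simpl; ring.
Qed.

Lemma Rpower_32_minus_1 q : Rpower q (3 / 2 - INR 1) = Rpower q (1 / 2).
Proof. f_equal; simpl; lra. Qed.

Lemma Rpower_32_minus_2 q : Rpower q (3 / 2 - INR 2) = / Rpower q (1 / 2).
Proof. rewrite <- Rpower_Ropp; f_equal; simpl; lra. Qed.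

Lemma q32_coef_1 t : q32_coef 1 t = Rpower (p t) (1 / 2) * v1 t * (- (3 / 2)).
Proof.
  unfold q32_coef, pow32_coef; cbn [sum_f_R0].
  rewrite Rpower_32_minus_1.
  unfold PS_pow, PS_mult, PS_unit, gbinom; simpl.
  rewrite qtail_0; unfold qtail; rewrite v_1_eq; field.
Qed.

Lemma v_2_eq xi : 0 <= xi <= 1 -> v 2 xi = v2 xi.
Proof.
  intros Hx; rewrite v_succ_clamp by auto; unfold avg, v2.
  assert (C : cont (fun t => t ^ 4 * (Rpower (p (clamp01 t)) (1 / 2) * v 1 (clamp01 t)))).
  { apply cont_mult; [apply cont_pow, cont_id|].
    apply cont_mult; [|apply (cont_v_q32 1)].
    apply cont_Rpower.
    - intros t; generalize (p_range _ (clamp01_range t)); lra.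
    - apply (cont_comp clamp01 p); [apply cont_clamp01|apply cont_p]. }
  assert (E1 : RInt (fun t => t ^ 4 * q32_clamped 1 t) 0 xi
    = RInt (fun t => t ^ 4 * (Rpower (p (clamp01 t)) (1 / 2) * v 1 (clamp01 t))) 0 xi
      * (- (3 / 2))).
  { rewrite <- RInt_mult_r by auto; apply RInt_ext; intros t _.
    unfold q32_clamped; rewrite q32_coef_1, v_1_eq.
    match goal with |- ?a = ?b => change (@eq R a b) end; ring. }
  assert (E2 : RInt (fun t => t ^ 4 * (Rpower (p (clamp01 t)) (1 / 2) * v 1 (clamp01 t))) 0 xi
    = RInt (fun t => t ^ 4 * Rpower (p t) (1 / 2) * v1 t) 0 xi).
  { apply RInt_ext; intros t Ht; rewrite Rmin_left, Rmax_right in Ht by lra.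
    rewrite clamp01_id, v_1_eq by lra; symmetry; apply Rmult_assoc. }
  rewrite E1, E2; match goal with |- ?a = ?b => change (@eq R a b) end; ring.
Qed.

Lemma v_3_eq xi : 0 <= xi <= 1 -> v 3 xi = v3 xi.
Proof.
  intros Hx; rewrite v_succ; unfold avg, v3; f_equal; apply RInt_ext; intros t Ht.
  rewrite Rmin_left, Rmax_right in Ht by lra; f_equal.
  unfold q32_coef, pow32_coef; cbn [sum_f_R0].
  rewrite Rpower_32_minus_1, Rpower_32_minus_2.
  unfold PS_pow, PS_mult, PS_unit, gbinom; simpl.
  rewrite qtail_0; unfold qtail; rewrite v_1_eq, v_2_eq by lra.
  field; unfold Rpower; apply Rgt_not_eq, exp_pos.
Qed.

Lemma PS_pow_low_coefs a m :
  a 0%nat = 1 ->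
  PS_pow a m 0%nat = 1 /\
  PS_pow a m 1%nat = INR m * a 1%nat /\
  PS_pow a m 2%nat = INR m * a 2%nat + INR m * (INR m - 1) / 2 * a 1%nat ^ 2 /\
  PS_pow a m 3%nat = INR m * a 3%nat + INR m * (INR m - 1) * (a 1%nat * a 2%nat)
    + INR m * (INR m - 1) * (INR m - 2) / 6 * a 1%nat ^ 3.
Proof.
  intros Ha; induction m as [|m [I0 [I1 [I2 I3]]]].
  - simpl; unfold PS_unit; simpl; repeat split; field.
  - rewrite S_INR; cbn [PS_pow]; unfold PS_mult; cbn [sum_f_R0 Nat.sub].
    rewrite I0, I1, I2, I3, Ha; repeat split; field.
Qed.

Section LowCoefs.
Let a1 := half_coef 1.
Let a2 := half_coef 2.
Let a3 := half_coef 3.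
Let C1 := crossing_coef 1.
Let C2 := crossing_coef 2.
Let C3 := crossing_coef 3.

(** Degrees [1], [2] and [3] of [half_coef_spec], with [kappa ^ 2 = 8] *)
Lemma half_low_coefs :
  a1 = C1 * kappa / 2 /\ a2 = 2 * a1 ^ 2 /\
  a3 = 21 / 2 * a1 ^ 3 - 20 * C2 * a1 + 4 * C3 * kappa.
Proof.
  assert (L := fun m => PS_pow_low_coefs half_coef m half_coef_0).
  assert (K2 := kappa_sqr).
  assert (E1 := half_coef_spec 1); assert (E2 := half_coef_spec 2);
  assert (E3 := half_coef_spec 3).
  cbn [sum_f_R0] in E1, E2, E3; simpl Nat.sub in E1, E2, E3.
  destruct (L 4%nat) as [_ [P41 [P42 P43]]]; destruct (L 7%nat) as [P70 [P71 [P72 _]]].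
  destruct (L 10%nat) as [P100 [P101 _]]; destruct (L 13%nat) as [P130 _].
  simpl Nat.mul in E1, E2, E3; simpl Nat.add in E1, E2, E3.
  rewrite P41, P70 in E1; rewrite P42, P71, P100 in E2; rewrite P43, P72, P101, P130 in E3.
  fold a1 a2 a3 C1 C2 C3 in E1, E2, E3.
  change (crossing_coef 0) with 1 in E1, E2, E3.
  simpl in E1, E2, E3.
  assert (K3 : kappa ^ 3 = 8 * kappa) by (replace (kappa ^ 3) with (kappa * kappa ^ 2) by ring;
    rewrite K2; ring).
  assert (H1 : a1 = C1 * kappa / 2) by lra.
  assert (CK : C1 * kappa = 2 * a1) by lra.
  assert (H2 : a2 = 2 * a1 ^ 2) by nra.
  split; [auto|split; [auto|]].
  assert (X : 4 * a3 + 12 * (a1 * a2) + 4 * a1 ^ 3 - (C1 * kappa) * (7 * a2 + 21 * a1 ^ 2)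
      + C2 * kappa ^ 2 * (10 * a1) - C3 * kappa ^ 3 = C3 * kappa ^ 3) by nra.
  rewrite CK, K2, K3, H2 in X; nra.
Qed.

Lemma return_low_coefs :
  return_coef 1 = C1 * kappa /\ return_coef 2 = 16 * C1 ^ 2 /\
  return_coef 3 = kappa * (49 * C1 ^ 3 - 20 * C2 * C1 + 8 * C3).
Proof.
  assert (L := fun m => PS_pow_low_coefs half_coef m half_coef_0).
  destruct half_low_coefs as [H1 [H2 H3]].
  assert (K2 := kappa_sqr).
  unfold return_coef; cbn [sum_f_R0]; simpl Nat.sub.
  simpl Nat.mul; simpl Nat.add.
  destruct (L 1%nat) as [_ [P11 [P12 P13]]]; destruct (L 4%nat) as [P40 [P41 [P42 _]]].
  destruct (L 7%nat) as [P70 [P71 _]]; destruct (L 10%nat) as [P100 _].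
  rewrite P11, P12, P13, P40, P41, P42, P70, P71, P100.
  fold a1 a2 a3; rewrite half_coef_0; simpl INR.
  assert (K3 : a1 ^ 3 = C1 ^ 3 * kappa).
  { rewrite H1; replace ((C1 * kappa / 2) ^ 3) with (C1 ^ 3 * kappa * kappa ^ 2 / 8) by field.
    rewrite K2; field. }
  assert (K4 : a1 ^ 2 = 2 * C1 ^ 2).
  { rewrite H1; replace ((C1 * kappa / 2) ^ 2) with (C1 ^ 2 * kappa ^ 2 / 4) by field.
    rewrite K2; field. }
  split; [lra|split].
  - transitivity (8 * a1 ^ 2); [rewrite H2; field|rewrite K4; ring].
  - transitivity (49 * a1 ^ 3 - 40 * C2 * a1 + 8 * C3 * kappa).
    + rewrite H3, H2; field.
    + rewrite K3, H1; field.
Qed.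
End LowCoefs.

(** * The full turn *)

(** At half the radius [half_radius] the outer series has ratio [1331/2000 < 1] against
    the cube of the bound [11/10] for the inner one. *)
Lemma return_value s :
  Rabs s <= half_radius / 4 ->
  is_pseries return_coef s
    (PSeries half_coef s * PSeries half_coef (s * PSeries half_coef s ^ 3)).
Proof.
  intros Hs.
  assert (H := is_pseries_subst half_coef half_coef 1 (half_radius / 2) (11 / 10) (11 / 10)
     (1331 / 2000) s).
  rewrite pow_1 in H; apply H; clear H; try (unfold half_radius in *; lra).
  - apply wbound_mono with half_radius; [unfold half_radius; lra|apply half_coef_bound].
  - intros j; unfold Rdiv at 1; rewrite Rpow_mult_distr, <- Rmult_assoc.
    rewrite (Rmult_assoc _ ((/ 2) ^ j)), <- Rpow_mult_distr.
    replace (/ 2 * (11 / 10) ^ 3) with (1331 / 2000) by field.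
    apply Rmult_le_compat_r; [apply pow_le; lra|].
    eapply Rle_trans; [apply (wnorm_term half_radius j); [unfold half_radius; lra|lia]|].
    apply half_coef_bound.
Qed.

Lemma opposite_solution eps x y t1 Z :
  is_solution eps x y -> 0 <= t1 -> x t1 = - Z -> y t1 = 0 ->
  is_solution Z (fun t => - x (t + t1)) (fun t => - y (t + t1)).
Proof.
  intros [_ [_ Hs]] Ht1 Hx Hy; split; [|split].
  - rewrite Rplus_0_l, Hx; ring.
  - rewrite Rplus_0_l, Hy; ring.
  - intros t Ht; destruct (Hs (t + t1)) as [Dx Dy]; [lra|].
    assert (S : is_derive (fun t => t + t1) t 1) by (auto_derive; auto).
    assert (D1 := is_derive_opp _ _ _ (is_derive_comp x _ _ _ _ Dx S)).
    assert (D2 := is_derive_opp _ _ _ (is_derive_comp y _ _ _ _ Dy S)).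
    split; [refine (is_derive_eq _ _ _ _ D1 _)|refine (is_derive_eq _ _ _ _ D2 _)];
      unfold opp, scal; simpl; unfold mult; simpl; ring.
Qed.

Lemma return_series (eps V : R) :
  is_pseries return_coef (eps ^ 3) V ->
  is_series (fun n => return_coef (S n) * eps ^ (3 * S n + 1)) (eps * V - eps).
Proof.
  intros H; apply is_pseries_R in H.
  assert (R0 : return_coef 0 = 1)
    by (unfold return_coef; simpl; unfold PS_mult, PS_unit; simpl; rewrite half_coef_0; ring).
  assert (H1 : is_series (fun n => return_coef (S n) * (eps ^ 3) ^ S n) (V - 1)).
  { apply (is_series_incr_1 (fun n => return_coef n * (eps ^ 3) ^ n)).
    refine (is_series_eq _ _ _ H _).
    rewrite R0; change (V = V - 1 + 1 * (eps ^ 3) ^ 0); simpl.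
    match goal with |- ?a = ?b => change (@eq R a b) end; ring. }
  apply (is_series_scal_l eps) in H1.
  replace (eps * V - eps) with (scal eps (V - 1))
    by (unfold scal; simpl; unfold mult; simpl; ring).
  refine (is_series_ext _ _ _ _ H1).
  intros n; change (eps * (return_coef (S n) * (eps ^ 3) ^ S n)
    = return_coef (S n) * eps ^ (3 * S n + 1)).
  rewrite pow_add, pow_mult, pow_1; ring.
Qed.

Theorem proposition1 :
  exists (eps0 : R) (X : nat -> R),
    0 < eps0 /\
    (forall eps : R, 0 < eps < eps0 ->
      (exists x y : R -> R, is_solution eps x y) /\
      (forall x y : R -> R, is_solution eps x y ->
        exists ts : R,
          first_return x y ts /\
          ex_series (fun n : nat => X (S n) * eps ^ (3 * S n + 1)) /\
          x ts = eps + Series (fun n : nat => X (S n) * eps ^ (3 * S n + 1)))) /\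
    (forall n : nat, (1 <= n)%nat -> X n = return_coef n) /\
    let c1 := v1 1 in
    let c2 := v2 1 in
    let c3 := v3 1 in
    X 1%nat = - Rpower 2 (3 / 2) * c1 /\
    X 2%nat = 16 * c1 ^ 2 /\
    X 3%nat = - Rpower 2 (3 / 2) * (20 * c2 * c1 + 8 * c3 + 49 * c1 ^ 3).
Proof.
  exists (1 / 20), return_coef; split; [lra|split; [|split]].
  - intros eps He; split; [now apply solution_exists|].
    intros x y Hsol.
    assert (P3 : 0 < eps ^ 3 <= 1 / 8000).
    { split; [apply pow_lt; lra|].
      apply Rle_trans with ((1 / 20) ^ 3); [apply pow_incr; lra|lra]. }
    destruct (half_return eps x y) as [PZ [Z3 [t1 [Ht1 [Y1 [X1 Pos1]]]]]];
      [lra|unfold half_radius; lra|auto|].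
    set (Z := eps * PSeries half_coef (eps ^ 3)) in *.
    assert (Sol2 := opposite_solution eps x y t1 Z Hsol (Rlt_le _ _ Ht1) X1 Y1).
    destruct (half_return Z _ _ PZ ltac:(unfold half_radius; lra) Sol2)
      as [PZ2 [_ [t2 [Ht2 [Y2 [X2 Pos2]]]]]].
    assert (RV := return_value (eps ^ 3)).
    assert (EZ : Z ^ 3 = eps ^ 3 * PSeries half_coef (eps ^ 3) ^ 3) by (unfold Z; ring).
    rewrite <- EZ in RV.
    assert (Hv : Rabs (eps ^ 3) <= half_radius / 4) by (rewrite Rabs_pos_eq; unfold half_radius; lra).
    apply RV, return_series in Hv; clear RV.
    exists (t2 + t1); split; [|split].
    + split; [lra|split; [lra|split; [lra|]]].
      intros t Ht [Yt Xt].
      destruct (Rtotal_order t t1) as [L|[->|G]].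
      * assert (P := Pos1 t ltac:(lra)); lra.
      * lra.
      * assert (P := Pos2 (t - t1) ltac:(lra)); cbv beta in P.
        replace (t - t1 + t1) with t in P by ring; lra.
    + eexists; exact Hv.
    + rewrite (is_series_unique _ _ Hv).
      replace (x (t2 + t1)) with (Z * PSeries half_coef (Z ^ 3)) by lra.
      unfold Z at 1; ring.
  - reflexivity.
  - destruct return_low_coefs as [R1 [R2 R3]].
    assert (E1 : crossing_coef 1 = - v1 1) by (rewrite <- v_1_eq; reflexivity).
    assert (E2 : crossing_coef 2 = - v2 1) by (rewrite <- v_2_eq by lra; reflexivity).
    assert (E3 : crossing_coef 3 = - v3 1) by (rewrite <- v_3_eq by lra; reflexivity).
    rewrite E1 in R1, R2, R3; rewrite E2, E3 in R3; unfold kappa in *.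
    cbv zeta; rewrite R1, R2, R3; repeat split; ring.
Qed.
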